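(* Let $\mathcal{C}$ be a category with finite limits and stable finite colimits, so that its canonical indexing $\mathbb{C}$ (with fibres $\mathbb{C}^X=\mathcal{C}/X$ and reindexing by pullback) is a $\mathcal{C}$-cocomplete $\mathcal{C}$-indexed category, and let $F$ be a small-based indexed endofunctor on $\mathbb{C}$. If the component $F^1:\mathcal{C}\to\mathcal{C}$ takes pullbacks to weak pullbacks, then $F$ has an indexed final coalgebra, i.e. there is an $F^1$-coalgebra $(T,\tau)$ in $\mathcal{C}$ such that for every object $X$ of $\mathcal{C}$ the reindexed coalgebra $X^*(T,\tau)$ is terminal in the category of $F^X$-coalgebras.
   Context: Write $\mathcal{S}=\mathcal{C}$ for the base of indexing (a category with finite limits). An $\mathcal{S}$-indexed category $\mathbb{D}$ has a fibre category $\mathbb{D}^X$ for each object $X$ of $\mathcal{S}$ and reindexing functors $f^*:\mathbb{D}^X\to\mathbb{D}^Y$ for each $f:Y\to X$, functorial up to coherent isomorphism (coherence isomorphisms are suppressed); $X^*$ denotes reindexing along $X\to 1$. Indexed functors have components on fibres commuting with reindexing up to coherent isomorphism. $\mathbb{D}$ is $\mathcal{S}$-cocomplete if each fibre is finitely cocomplete, finite colimits are preserved by reindexing functors, and reindexing functors have left adjoints satisfying the Beck-Chevalley condition. Internal colimits. An internal category $\mathbf{K}$ in $\mathcal{S}$ has objects $K_0,K_1$, domain map $d_1:K_1\to K_0$, codomain map $d_0:K_1\to K_0$, a common section $i:K_0\to K_1$ giving identities, and a composition, with the usual axioms. An internal diagram $L$ of shape $\mathbf{K}$ in $\mathbb{D}$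 is an object $L$ of $\mathbb{D}^{K_0}$ with a map $d_1^*L\to d_0^*L$ in $\mathbb{D}^{K_1}$ compatible with identities and composition. With the evident morphisms these form a category $\mathbb{D}^{\mathbf{K}}$. The functor $\mathbf{K}^*:\mathbb{D}^1\to\mathbb{D}^{\mathbf{K}}$ sends $A$ to the constant diagram $K_0^*A$; its left adjoint, which exists if $\mathbb{D}$ is $\mathcal{S}$-cocomplete, is denoted $\mathrm{colim}_{\mathbf{K}}$. Exponentiable objects. An object $E$ of $\mathbb{D}^U$ is exponentiable if for every object $A$ in any fibre $\mathbb{D}^I$ there are a span $U\xleftarrow{s}A^E\xrightarrow{t}I$ in $\mathcal{S}$ and a generic arrow $\varepsilon:s^*E\to t^*A$ in $\mathbb{D}^{A^E}$ such that for any span $U\xleftarrow{x}J\xrightarrow{y}I$ and any $\psi:x^*E\to y^*A$ in $\mathbb{D}^J$ there is a unique $\chi:J\to A^E$ with $s\chi=x$, $t\chi=y$ and $\chi^*\varepsilon\cong\psi$ (via the canonical isomorphisms). Canonical cocone. For $E$ exponentiable in $\mathbb{D}^U$ and $A$ in $\mathbb{D}^1$, the canonical cocone from $E$ to $A$ is the internal diagram $(\mathbf{K}^A,L^A)$ defined as follows. $K_0^A=A^E$ with its map $s:A^E\to U$ and generic arrow $\varepsilon$. Let $U\xleftarrow{\bar s}E^E\xrightarrow{\bar t}U$ be the exponential of $E$ with itself, with generic arrow $\bar\varepsilon:\bar s^*E\to\bar t^*E$; $K_1^A$ is the pullback of $\bar t$ along $s$, with projections $x:K_1^A\to E^E$ and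 $d_0:K_1^A\to K_0^A$ (so $\bar t x=sd_0$). The domain map $d_1$ is induced via the universal property of $A^E$ by the composite $(\bar s x)^*E\xrightarrow{x^*\bar\varepsilon}(\bar t x)^*E\cong(sd_0)^*E\xrightarrow{d_0^*\varepsilon}(td_0)^*A$. Finally $L^A=s^*E$, with structure arrow $x^*\bar\varepsilon:d_1^*L^A\to d_0^*L^A$. Coalgebras. The indexed category $F\text{-}\mathbb{C}\mathrm{oalg}$ has as fibre over $I$ the category of $F^I$-coalgebras (pairs $(A,\alpha)$ with $\alpha:A\to F^IA$ in $\mathcal{C}/I$, and the usual coalgebra morphisms), with the evident reindexing; $U:F\text{-}\mathbb{C}\mathrm{oalg}\to\mathbb{C}$ is the forgetful indexed functor. Small-based. $F$ is small-based if there are an object $V$ of $\mathcal{C}$ and an $F^V$-coalgebra $(E,\varepsilon)$ which is an exponentiable object of $F\text{-}\mathbb{C}\mathrm{oalg}$ (in the fibre over $V$) such that for any $F^1$-coalgebra $(A,\alpha)$ the canonical cocone $(\mathbf{K}^{(A,\alpha)},L^{(A,\alpha)})$ from $(E,\varepsilon)$ to $(A,\alpha)$ satisfies $\mathrm{colim}_{\mathbf{K}^{(A,\alpha)}}UL^{(A,\alpha)}\cong U(A,\alpha)=A$, where the isomorphism is the canonical map induced by the generic arrow. *)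

(* Defs.v *)
From Corelib Require Import ssreflect.
From Stdlib Require Import List ProofIrrelevance.

Set Implicit Arguments.
Unset Strict Implicit.
Unset Printing Implicit Defensive.

Record Category := {
  ob :> Type;
  hom : ob -> ob -> Type;
  idm : forall a, hom a a;
  comp : forall a b c, hom b c -> hom a b -> hom a c;
  comp_idl : forall a b (f : hom a b), comp (idm b) f = f;
  comp_idr : forall a b (f : hom a b), comp f (idm a) = f;
  comp_assoc : forall a b c d (h : hom c d) (g : hom b c) (f : hom a b),
    comp h (comp g f) = comp (comp h g) f }.

Arguments hom {C} _ _ : rename.
Arguments idm {C} a : rename.
Arguments comp {C a b c} _ _ : rename.

Notation "g ∘ f" := (comp g f) (at level 40, left associativity).

Record Iso (C : Category) (a b : C) := {
  to : hom a b;
  from : hom b a;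
  from_to : from ∘ to = idm a;
  to_from : to ∘ from = idm b }.

Definition is_iso (C : Category) (a b : C) (f : hom a b) : Prop :=
  exists g : hom b a, g ∘ f = idm a /\ f ∘ g = idm b.

Record Functor (A B : Category) := {
  fob :> A -> B;
  fmap : forall a b, hom a b -> hom (fob a) (fob b);
  fmap_id : forall a, fmap (idm a) = idm (fob a);
  fmap_comp : forall a b c (g : hom b c) (f : hom a b),
    fmap (g ∘ f) = fmap g ∘ fmap f }.

Arguments fmap {A B} F {a b} _ : rename.

Definition is_terminal (C : Category) (t : C) : Prop :=
  forall a : C, exists! f : hom a t, True.

Record LeftAdjoint (A B : Category) (G : Functor B A) := {
  ladj :> Functor A B;
  ladj_unit : forall a, hom a (G (ladj a));
  ladj_unit_nat : forall a a' (f : hom a a'),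
    ladj_unit a' ∘ f = fmap G (fmap ladj f) ∘ ladj_unit a;
  transpose : forall a b, hom a (G b) -> hom (ladj a) b;
  transpose_unit : forall a b (u : hom a (G b)),
    fmap G (transpose u) ∘ ladj_unit a = u;
  transpose_uniq : forall a b (u : hom a (G b)) (v : hom (ladj a) b),
    fmap G v ∘ ladj_unit a = u -> v = transpose u }.

Definition finite_type (T : Type) : Prop := exists l : list T, forall x, In x l.

Definition finite_category (J : Category) : Prop :=
  finite_type J /\ forall a b : J, finite_type (hom a b).

Section Limits.
Variables (J C : Category) (D : Functor J C) (c : C).

Definition is_cone (k : forall j, hom c (D j)) : Prop :=
  forall i j (f : hom i j), fmap D f ∘ k i = k j.

Definition is_cocone (k : forall j, hom (D j) c) : Prop :=
  forall i j (f : hom i j), k j ∘ fmap D f = k i.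

End Limits.

Definition is_limit (J C : Category) (D : Functor J C) (c : C)
    (k : forall j, hom c (D j)) : Prop :=
  is_cone k /\
  forall (x : C) (l : forall j, hom x (D j)), is_cone l ->
    exists! u : hom x c, forall j, k j ∘ u = l j.

Definition is_colimit (J C : Category) (D : Functor J C) (c : C)
    (k : forall j, hom (D j) c) : Prop :=
  is_cocone k /\
  forall (x : C) (l : forall j, hom (D j) x), is_cocone l ->
    exists! u : hom c x, forall j, u ∘ k j = l j.

Definition has_finite_limits (C : Category) : Prop :=
  forall (J : Category) (D : Functor J C), finite_category J ->
    exists (c : C) (k : forall j, hom c (D j)), is_limit k.

Definition has_finite_colimits (C : Category) : Prop :=
  forall (J : Category) (D : Functor J C), finite_category J ->
    exists (c : C) (k : forall j, hom (D j) c), is_colimit k.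

Program Definition compose_functor (A B C : Category)
    (G : Functor B C) (F : Functor A B) : Functor A C :=
  {| fob := fun a => G (F a); fmap := fun a b f => fmap G (fmap F f) |}.
Next Obligation. by rewrite !fmap_id. Qed.
Next Obligation. by rewrite !fmap_comp. Qed.

Definition preserves_finite_colimits (A B : Category) (G : Functor A B) : Prop :=
  forall (J : Category) (D : Functor J A) (c : A) (k : forall j, hom (D j) c),
    finite_category J -> is_colimit k ->
    is_colimit (D := compose_functor G D) (fun j => fmap G (k j)).

Section PullbackSquares.
Variables (C : Category) (P X Y Z : C).
Variables (f : hom X Z) (g : hom Y Z) (p : hom P X) (q : hom P Y).

Definition is_pullback : Prop :=
  f ∘ p = g ∘ q /\
  forall (J : C) (a : hom J X) (b : hom J Y), f ∘ a = g ∘ b ->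
    exists! u : hom J P, p ∘ u = a /\ q ∘ u = b.

Definition is_weak_pullback : Prop :=
  f ∘ p = g ∘ q /\
  forall (J : C) (a : hom J X) (b : hom J Y), f ∘ a = g ∘ b ->
    exists u : hom J P, p ∘ u = a /\ q ∘ u = b.

End PullbackSquares.

Definition pullbacks_to_weak_pullbacks (A B : Category) (G : Functor A B) : Prop :=
  forall (P X Y Z : A) (f : hom X Z) (g : hom Y Z) (p : hom P X) (q : hom P Y),
    is_pullback f g p q ->
    is_weak_pullback (fmap G f) (fmap G g) (fmap G p) (fmap G q).

Record Pullback (C : Category) (X Y Z : C) (f : hom X Z) (g : hom Y Z) := {
  pb :> C;
  pb_fst : hom pb X;
  pb_snd : hom pb Y;
  pb_sq : f ∘ pb_fst = g ∘ pb_snd;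
  pb_pair : forall (J : C) (a : hom J X) (b : hom J Y), f ∘ a = g ∘ b -> hom J pb;
  pb_pair_fst : forall J a b (e : f ∘ a = g ∘ b), pb_fst ∘ @pb_pair J a b e = a;
  pb_pair_snd : forall J a b (e : f ∘ a = g ∘ b), pb_snd ∘ @pb_pair J a b e = b;
  pb_ext : forall J (u v : hom J pb),
    pb_fst ∘ u = pb_fst ∘ v -> pb_snd ∘ u = pb_snd ∘ v -> u = v }.

Arguments pb_fst {C X Y Z f g} _.
Arguments pb_snd {C X Y Z f g} _.
Arguments pb_sq {C X Y Z f g} _.
Arguments pb_pair {C X Y Z f g} _ {J a b} _.

(** The terminal object and the pullbacks are chosen once and for all, since
    the reindexing functors [f^*] and [X^*] depend on these choices. *)
Record FinLimCategory := {
  flcat :> Category;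
  flcat_limits : has_finite_limits flcat;
  one : flcat;
  bang : forall X : flcat, hom X one;
  bang_uniq : forall (X : flcat) (f g : hom X one), f = g;
  pbk : forall (X Y Z : flcat) (f : hom X Z) (g : hom Y Z), Pullback f g }.

Arguments one {C} : rename.
Arguments bang {C} X : rename.
Arguments pbk {C X Y Z} _ _ : rename.

(** A pseudofunctor [S^op -> CAT].  The comparison isomorphism
    [g^* f^* A ≅ (f g)^* A] is given as [g^* f^* A ≅ h^* A] for every proof of
    [f g = h]; this is the same data, and the coherence axioms can then be
    written without transport along the category axioms of [S]. *)
Record IndexedCategory (S : Category) := {
  fib :> S -> Category;
  reix : forall (X Y : S), hom Y X -> Functor (fib X) (fib Y);
  reix_id : forall (X : S) (A : fib X), Iso A (reix (idm X) A);
  reix_comp : forall (X Y Z : S) (f : hom Y X) (g : hom Z Y) (h : hom Z X)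
    (e : f ∘ g = h) (A : fib X), Iso (reix g (reix f A)) (reix h A);
  reix_id_nat : forall (X : S) (A B : fib X) (u : hom A B),
    to (reix_id B) ∘ u = fmap (reix (idm X)) u ∘ to (reix_id A);
  reix_comp_nat : forall (X Y Z : S) (f : hom Y X) (g : hom Z Y) (h : hom Z X)
    (e : f ∘ g = h) (A B : fib X) (u : hom A B),
    to (reix_comp e B) ∘ fmap (reix g) (fmap (reix f) u)
    = fmap (reix h) u ∘ to (reix_comp e A);
  reix_unitl : forall (X Y : S) (f : hom Y X) (e : f ∘ idm Y = f) (A : fib X),
    to (reix_comp e A) ∘ to (reix_id (reix f A)) = idm _;
  reix_unitr : forall (X Y : S) (f : hom Y X) (e : idm X ∘ f = f) (A : fib X),
    to (reix_comp e A) ∘ fmap (reix f) (to (reix_id A)) = idm _;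
  reix_coh : forall (X Y Z W : S) (f : hom Y X) (g : hom Z Y) (k : hom W Z)
    (fg : hom Z X) (gk : hom W Y) (l : hom W X)
    (e1 : f ∘ g = fg) (e2 : fg ∘ k = l) (e3 : g ∘ k = gk) (e4 : f ∘ gk = l)
    (A : fib X),
    to (reix_comp e2 A) ∘ fmap (reix k) (to (reix_comp e1 A))
    = to (reix_comp e4 A) ∘ to (reix_comp e3 (reix f A)) }.

Arguments reix {S D X Y} _ : rename.
Arguments reix_id {S D X} A : rename.
Arguments reix_comp {S D X Y Z f g h} e A : rename.

Record IndexedFunctor (S : Category) (D D' : IndexedCategory S) := {
  cmpt :> forall X : S, Functor (D X) (D' X);
  cmpt_reix : forall (X Y : S) (f : hom Y X) (A : D X),
    Iso (cmpt Y (reix f A)) (reix f (cmpt X A));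
  cmpt_reix_nat : forall (X Y : S) (f : hom Y X) (A B : D X) (u : hom A B),
    to (cmpt_reix f B) ∘ fmap (cmpt Y) (fmap (reix f) u)
    = fmap (reix f) (fmap (cmpt X) u) ∘ to (cmpt_reix f A);
  cmpt_reix_id : forall (X : S) (A : D X),
    to (cmpt_reix (idm X) A) ∘ fmap (cmpt X) (to (reix_id A))
    = to (reix_id (cmpt X A));
  cmpt_reix_comp : forall (X Y Z : S) (f : hom Y X) (g : hom Z Y) (h : hom Z X)
    (e : f ∘ g = h) (A : D X),
    to (cmpt_reix h A) ∘ fmap (cmpt Z) (to (reix_comp e A))
    = to (reix_comp e (cmpt X A))
      ∘ (fmap (reix g) (to (cmpt_reix f A)) ∘ to (cmpt_reix g (reix f A))) }.

Arguments cmpt_reix {S D D'} H {X Y} f A : rename.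

Section Slice.
Variables (C : Category) (X : C).

Record slice_ob := { sl_dom :> C; sl_arr : hom sl_dom X }.

Record slice_hom (A B : slice_ob) := {
  sl_map :> hom (sl_dom A) (sl_dom B);
  sl_tri : sl_arr B ∘ sl_map = sl_arr A }.

Lemma slice_hom_eq A B (u v : slice_hom A B) : sl_map u = sl_map v -> u = v.
Proof.
case: u v => [u eu] [v ev] /= e; subst v; by rewrite (proof_irrelevance _ eu ev).
Qed.

Program Definition Slice : Category :=
  {| ob := slice_ob; hom := slice_hom;
     idm := fun A => {| sl_map := idm _ |};
     comp := fun A B D g f => {| sl_map := sl_map g ∘ sl_map f |} |}.
Next Obligation. by rewrite comp_idr. Qed.
Next Obligation. by rewrite comp_assoc !sl_tri. Qed.
Next Obligation. by apply: slice_hom_eq; rewrite /= comp_idl. Qed.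
Next Obligation. by apply: slice_hom_eq; rewrite /= comp_idr. Qed.
Next Obligation. by apply: slice_hom_eq; rewrite /= comp_assoc. Qed.

End Slice.

Section CanonicalIndexing.
Variable C : FinLimCategory.

Program Definition slice_reix (X Y : C) (f : hom Y X) :
    Functor (Slice X) (Slice Y) :=
  {| fob := fun A : slice_ob X =>
       {| sl_dom := pbk f (sl_arr A); sl_arr := pb_fst _ |};
     fmap := fun A B (u : slice_hom A B) =>
       {| sl_map := pb_pair (pbk f (sl_arr B)) (a := pb_fst (pbk f (sl_arr A)))
                            (b := sl_map u ∘ pb_snd (pbk f (sl_arr A))) _ |} |}.
Next Obligation. by rewrite comp_assoc sl_tri pb_sq. Qed.
Next Obligation. by rewrite /= pb_pair_fst. Qed.
Next Obligation.
apply: slice_hom_eq; apply: pb_ext => /=.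
  by rewrite pb_pair_fst comp_idr.
by rewrite pb_pair_snd comp_idl comp_idr.
Qed.
Next Obligation.
apply: slice_hom_eq; apply: pb_ext => /=.
  by rewrite comp_assoc !pb_pair_fst.
by rewrite comp_assoc !pb_pair_snd -!comp_assoc pb_pair_snd.
Qed.

Program Definition slice_reix_id (X : C) (A : Slice X) :
    Iso A (slice_reix (idm X) A) :=
  {| to := {| sl_map := pb_pair (pbk (idm X) (sl_arr A)) (a := sl_arr A)
                                (b := idm (sl_dom A)) _ |};
     from := {| sl_map := pb_snd (pbk (idm X) (sl_arr A)) |} |}.
Next Obligation. by rewrite comp_idl comp_idr. Qed.
Next Obligation. by rewrite /= pb_pair_fst. Qed.
Next Obligation. by rewrite /= -pb_sq comp_idl. Qed.
Next Obligation. by apply: slice_hom_eq; rewrite /= pb_pair_snd. Qed.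
Next Obligation.
apply: slice_hom_eq; apply: pb_ext => /=; rewrite comp_assoc.
  by rewrite pb_pair_fst comp_idr -pb_sq comp_idl.
by rewrite pb_pair_snd comp_idl comp_idr.
Qed.

Program Definition slice_reix_comp (X Y Z : C) (f : hom Y X) (g : hom Z Y)
    (h : hom Z X) (e : f ∘ g = h) (A : Slice X) :
    Iso (slice_reix g (slice_reix f A)) (slice_reix h A) :=
  let P := pbk f (sl_arr A) in
  let Q := pbk g (pb_fst P) in
  let R := pbk h (sl_arr A) in
  {| to := {| sl_map := pb_pair R (a := pb_fst Q) (b := pb_snd P ∘ pb_snd Q) _ |};
     from := {| sl_map := pb_pair Q (a := pb_fst R)
       (b := pb_pair P (a := g ∘ pb_fst R) (b := pb_snd R) _) _ |} |}.
Next Obligation.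
by rewrite comp_assoc -pb_sq -!comp_assoc pb_sq.
Qed.
Next Obligation. by rewrite /= pb_pair_fst. Qed.
Next Obligation. by rewrite comp_assoc pb_sq. Qed.
Next Obligation. by rewrite pb_pair_fst. Qed.
Next Obligation. by rewrite /= pb_pair_fst. Qed.
Next Obligation.
apply: slice_hom_eq; apply: pb_ext => /=; rewrite comp_assoc comp_idr.
  by rewrite !pb_pair_fst.
rewrite pb_pair_snd; apply: pb_ext; rewrite comp_assoc.
  by rewrite pb_pair_fst -comp_assoc pb_pair_fst pb_sq.
by rewrite pb_pair_snd pb_pair_snd.
Qed.
Next Obligation.
apply: slice_hom_eq; apply: pb_ext => /=; rewrite comp_assoc comp_idr.
  by rewrite !pb_pair_fst.
by rewrite pb_pair_snd -comp_assoc !pb_pair_snd.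
Qed.

(** The fibre over [one] is [C/1], which is isomorphic to [C] and stands for it:
    [F^1] and the coalgebras over [one] live in [C/1]. *)
Program Definition CanonicalIndexing : IndexedCategory C :=
  {| fib := fun X => Slice X;
     reix := slice_reix;
     reix_id := slice_reix_id;
     reix_comp := slice_reix_comp |}.
Next Obligation.
apply: slice_hom_eq; apply: pb_ext => /=; rewrite !comp_assoc.
  by rewrite !pb_pair_fst sl_tri.
by rewrite !pb_pair_snd -comp_assoc pb_pair_snd comp_idl comp_idr.
Qed.
Next Obligation.
apply: slice_hom_eq; apply: pb_ext => /=; rewrite !comp_assoc.
  by rewrite !pb_pair_fst.
by rewrite !pb_pair_snd -!comp_assoc !pb_pair_snd !comp_assoc pb_pair_snd.
Qed.
Next Obligation.
apply: slice_hom_eq; apply: pb_ext => /=; rewrite !comp_assoc comp_idr.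
  by rewrite !pb_pair_fst.
by rewrite pb_pair_snd -comp_assoc pb_pair_snd comp_idr.
Qed.
Next Obligation.
apply: slice_hom_eq; apply: pb_ext => /=; rewrite !comp_assoc comp_idr.
  by rewrite !pb_pair_fst.
by rewrite pb_pair_snd -comp_assoc !pb_pair_snd comp_assoc pb_pair_snd comp_idl.
Qed.
Next Obligation.
apply: slice_hom_eq; apply: pb_ext => /=; rewrite !comp_assoc.
  by rewrite !pb_pair_fst.
by rewrite !pb_pair_snd -!comp_assoc !pb_pair_snd !comp_assoc pb_pair_snd.
Qed.

End CanonicalIndexing.

Definition stable_finite_colimits (C : FinLimCategory) : Prop :=
  has_finite_colimits C /\
  forall (X Y : C) (f : hom Y X),
    preserves_finite_colimits (reix (D := CanonicalIndexing C) f).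

Section Transport.
Variables (S : Category) (D : IndexedCategory S).

(** For [psi : x^* E -> y^* A] over [J] and [chi : J' -> J], the composite
    [(x chi)^* E ≅ chi^* x^* E -> chi^* y^* A ≅ (y chi)^* A]. *)
Definition pull (U I J J' : S) (E : D U) (A : D I) (x : hom J U) (y : hom J I)
    (psi : hom (reix x E) (reix y A)) (chi : hom J' J)
    (x' : hom J' U) (y' : hom J' I) (ex : x ∘ chi = x') (ey : y ∘ chi = y') :
    hom (reix x' E) (reix y' A) :=
  to (reix_comp ey A) ∘ fmap (reix chi) psi ∘ from (reix_comp ex E).

(** An arrow [p^* E -> q^* A] seen as an arrow [h^* s^* E -> k^* t^* A],
    where [p = s h] and [q = t k]. *)
Definition rebase (J K L U I : S) (E : D U) (A : D I)
    (s : hom K U) (t : hom L I) (h : hom J K) (k : hom J L)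
    (p : hom J U) (q : hom J I) (ep : s ∘ h = p) (eq : t ∘ k = q)
    (psi : hom (reix p E) (reix q A)) :
    hom (reix h (reix s E)) (reix k (reix t A)) :=
  from (reix_comp eq A) ∘ psi ∘ to (reix_comp ep E).

Lemma compA' (C : Category) (a b c d : C) (h : hom c d) (g : hom b c)
  (f : hom a b) : (h ∘ g) ∘ f = h ∘ (g ∘ f).
Proof. by rewrite comp_assoc. Qed.

Lemma iso_tfK (C : Category) (a b c : C) (i : Iso a b) (f : hom c b) :
  to i ∘ (from i ∘ f) = f.
Proof. by rewrite comp_assoc to_from comp_idl. Qed.

Lemma iso_ftK (C : Category) (a b c : C) (i : Iso a b) (f : hom c a) :
  from i ∘ (to i ∘ f) = f.
Proof. by rewrite comp_assoc from_to comp_idl. Qed.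

Lemma iso_epi (C : Category) (a b c : C) (i : Iso a b) (f g : hom b c) :
  f ∘ to i = g ∘ to i -> f = g.
Proof.
move=> e; by rewrite -(comp_idr f) -(comp_idr g) -(to_from i) !comp_assoc e.
Qed.

Lemma iso_mono (C : Category) (a b c : C) (i : Iso a b) (f g : hom c a) :
  to i ∘ f = to i ∘ g -> f = g.
Proof.
move=> e; by rewrite -(comp_idl f) -(comp_idl g) -(from_to i) -!comp_assoc e.
Qed.

Program Definition fmap_iso (A B : Category) (G : Functor A B) (a b : A)
    (i : Iso a b) : Iso (G a) (G b) :=
  {| to := fmap G (to i); from := fmap G (from i) |}.
Next Obligation. by rewrite -fmap_comp from_to fmap_id. Qed.
Next Obligation. by rewrite -fmap_comp to_from fmap_id. Qed.

Lemma pullE (U I J J' : S) (E : D U) (A : D I) (x : hom J U) (y : hom J I)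
    (psi : hom (reix x E) (reix y A)) (chi : hom J' J)
    (x' : hom J' U) (y' : hom J' I) (ex : x ∘ chi = x') (ey : y ∘ chi = y') :
  pull psi ex ey ∘ to (reix_comp ex E)
  = to (reix_comp ey A) ∘ fmap (reix chi) psi.
Proof. by rewrite /pull !compA' from_to comp_idr. Qed.

Lemma pull_idm (U J J' : S) (E : D U) (x : hom J U) (chi : hom J' J)
    (x' : hom J' U) (ex ey : x ∘ chi = x') :
  pull (idm (reix x E)) ex ey = idm _.
Proof.
rewrite (proof_irrelevance _ ey ex).
apply: (iso_epi (i := reix_comp ex E)).
by rewrite pullE fmap_id comp_idl comp_idr.
Qed.

Lemma pull_comp (U V W J J' : S) (A : D U) (B : D V) (C : D W)
    (x : hom J U) (y : hom J V) (z : hom J W)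
    (phi : hom (reix x A) (reix y B)) (psi : hom (reix y B) (reix z C))
    (chi : hom J' J) x' y' z'
    (ex : x ∘ chi = x') (ey : y ∘ chi = y') (ez : z ∘ chi = z') :
  pull (psi ∘ phi) ex ez = pull psi ey ez ∘ pull phi ex ey.
Proof.
apply: (iso_epi (i := reix_comp ex A)).
by rewrite compA' !pullE comp_assoc pullE compA' fmap_comp.
Qed.

Lemma pull_pull (U I J J' J'' : S) (E : D U) (A : D I)
    (x : hom J U) (y : hom J I) (psi : hom (reix x E) (reix y A))
    (chi : hom J' J) (x' : hom J' U) (y' : hom J' I)
    (ex : x ∘ chi = x') (ey : y ∘ chi = y')
    (chi' : hom J'' J') (x'' : hom J'' U) (y'' : hom J'' I)
    (ex' : x' ∘ chi' = x'') (ey' : y' ∘ chi' = y'')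
    (chi'' : hom J'' J) (e : chi ∘ chi' = chi'')
    (ex'' : x ∘ chi'' = x'') (ey'' : y ∘ chi'' = y'') :
  pull (pull psi ex ey) ex' ey' = pull psi ex'' ey''.
Proof.
apply: (iso_epi (i := reix_comp ex' E)).
apply: (iso_epi (i := fmap_iso (reix chi') (reix_comp ex E))) => /=.
rewrite pullE -[LHS]comp_assoc -fmap_comp pullE fmap_comp [LHS]comp_assoc.
rewrite (reix_coh ey ey' e ey'') -[RHS]comp_assoc (reix_coh ex ex' e ex'').
by rewrite [RHS]comp_assoc pullE -[LHS]comp_assoc reix_comp_nat [LHS]comp_assoc.
Qed.

Lemma pull_id (U I J : S) (E : D U) (A : D I)
    (x : hom J U) (y : hom J I) (psi : hom (reix x E) (reix y A))
    (ex : x ∘ idm J = x) (ey : y ∘ idm J = y) :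
  pull psi ex ey = psi.
Proof.
apply: (iso_epi (i := reix_comp ex E)).
apply: (iso_epi (i := reix_id (reix x E))).
rewrite pullE !compA' -reix_id_nat reix_unitl comp_assoc.
by rewrite reix_unitl comp_idl comp_idr.
Qed.

Lemma pull_eq (U I J J' : S) (E : D U) (A : D I) (x : hom J U) (y : hom J I)
    (psi : hom (reix x E) (reix y A)) (chi chi2 : hom J' J) (x' : hom J' U)
    (y' : hom J' I) (ex : x ∘ chi = x') (ey : y ∘ chi = y')
    (ex2 : x ∘ chi2 = x') (ey2 : y ∘ chi2 = y') :
  chi = chi2 -> pull psi ex ey = pull psi ex2 ey2.
Proof.
move=> e; subst chi2.
by rewrite (proof_irrelevance _ ex ex2) (proof_irrelevance _ ey ey2).
Qed.

Lemma rebase_idm (J K U : S) (E : D U) (s : hom K U) (h : hom J K)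
    (p : hom J U) (ep eq : s ∘ h = p) :
  rebase ep eq (idm (reix p E)) = idm _.
Proof.
by rewrite (proof_irrelevance _ eq ep) /rebase comp_idr from_to.
Qed.

Lemma rebase_comp (J K L M U I V : S) (E : D U) (A : D I) (B : D V)
    (s : hom K U) (t : hom L I) (r : hom M V)
    (h : hom J K) (k : hom J L) (l : hom J M)
    (p : hom J U) (q : hom J I) (o : hom J V)
    (ep : s ∘ h = p) (eq : t ∘ k = q) (eo : r ∘ l = o)
    (phi : hom (reix p E) (reix q A)) (psi : hom (reix q A) (reix o B)) :
  rebase ep eo (psi ∘ phi) = rebase eq eo psi ∘ rebase ep eq phi.
Proof. by rewrite /rebase !compA' iso_tfK. Qed.

Lemma fmap_rebase (U I J J' : S) (E : D U) (A : D I) (x : hom J U) (y : hom J I)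
    (psi : hom (reix x E) (reix y A)) (chi : hom J' J)
    (x' : hom J' U) (y' : hom J' I) (ex : x ∘ chi = x') (ey : y ∘ chi = y') :
  fmap (reix chi) psi = rebase ex ey (pull psi ex ey).
Proof.
apply: (iso_mono (i := reix_comp ey A)); rewrite -(pullE psi ex ey).
by move: (pull psi ex ey) => u; rewrite /rebase !comp_assoc to_from comp_idl.
Qed.

Lemma pull_rebase (J J' K L U I : S) (E : D U) (A : D I)
    (s : hom K U) (t : hom L I) (h : hom J K) (k : hom J L)
    (p : hom J U) (q : hom J I) (ep : s ∘ h = p) (eq : t ∘ k = q)
    (psi : hom (reix p E) (reix q A)) (chi : hom J' J)
    (h' : hom J' K) (k' : hom J' L) (eh : h ∘ chi = h') (ek : k ∘ chi = k')
    (p' : hom J' U) (q' : hom J' I) (ep' : s ∘ h' = p') (eq' : t ∘ k' = q')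
    (fp : p ∘ chi = p') (fq : q ∘ chi = q') :
  pull (rebase ep eq psi) eh ek = rebase ep' eq' (pull psi fp fq).
Proof.
apply: (iso_epi (i := reix_comp eh (reix s E))).
apply: (iso_mono (i := reix_comp eq' A)).
rewrite pullE; move: (pull psi fp fq) (pullE psi fp fq) => u eu.
rewrite /rebase !compA' iso_tfK -(reix_coh ep fp eh ep') (comp_assoc u) eu.
rewrite !fmap_comp !comp_assoc -(reix_coh eq fq ek eq').
by rewrite !compA' (comp_assoc (fmap _ (to _))) -fmap_comp to_from fmap_id comp_idl.
Qed.

End Transport.

(** The image of [psi : x^* E -> y^* A] under an indexed functor, as an arrow
    [x^* H E -> y^* H A]. *)
Definition ipush (S : Category) (D D' : IndexedCategory S)
    (H : IndexedFunctor D D') (U I J : S) (E : D U) (A : D I)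
    (x : hom J U) (y : hom J I) (psi : hom (reix x E) (reix y A)) :
    hom (reix x (H U E)) (reix y (H I A)) :=
  to (cmpt_reix H y A) ∘ fmap (H J) psi ∘ from (cmpt_reix H x E).

Section PushLemmas.
Variables (S : Category) (D D' : IndexedCategory S) (H : IndexedFunctor D D').

Lemma ipushE (U I J : S) (E : D U) (A : D I)
    (x : hom J U) (y : hom J I) (psi : hom (reix x E) (reix y A)) :
  ipush H psi ∘ to (cmpt_reix H x E) = to (cmpt_reix H y A) ∘ fmap (H J) psi.
Proof. by rewrite /ipush !compA' from_to comp_idr. Qed.

Lemma ipush_idm (U J : S) (E : D U) (x : hom J U) :
  ipush H (idm (reix x E)) = idm _.
Proof. by rewrite /ipush fmap_id comp_idr to_from. Qed.

Lemma ipush_comp (U V W J : S) (A : D U) (B : D V) (C : D W)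
    (x : hom J U) (y : hom J V) (z : hom J W)
    (phi : hom (reix x A) (reix y B)) (psi : hom (reix y B) (reix z C)) :
  ipush H (psi ∘ phi) = ipush H psi ∘ ipush H phi.
Proof. by rewrite /ipush !compA' iso_ftK fmap_comp !compA'. Qed.

Lemma ipush_pull (U I J J' : S) (E : D U) (A : D I) (x : hom J U) (y : hom J I)
    (psi : hom (reix x E) (reix y A)) (chi : hom J' J)
    (x' : hom J' U) (y' : hom J' I) (ex : x ∘ chi = x') (ey : y ∘ chi = y') :
  ipush H (pull psi ex ey) = pull (ipush H psi) ex ey.
Proof.
apply: (iso_epi (i := cmpt_reix H x' E)); rewrite ipushE.
apply: (iso_epi (i := fmap_iso (H J') (reix_comp ex E))) => /=.
rewrite -[LHS]comp_assoc -fmap_comp pullE fmap_comp [LHS]comp_assoc.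
move: (pull (ipush H psi) ex ey) (pullE (ipush H psi) ex ey) => u eu.
move: (ipush H psi) (ipushE psi) eu => v ev eu.
rewrite cmpt_reix_comp -[RHS]comp_assoc cmpt_reix_comp [RHS]comp_assoc eu.
rewrite !compA' cmpt_reix_nat (comp_assoc (fmap _ v)) -fmap_comp ev.
by rewrite fmap_comp !compA'.
Qed.

End PushLemmas.

(** As in the literature on indexed categories, [d1] is the domain and [d0] the
    codomain.  The unit and associativity laws are stated on generalised
    elements [J -> K1], i.e. on [J]-indexed families of arrows. *)
Record InternalCategory (S : FinLimCategory) := {
  K0 : S;
  K1 : S;
  d1 : hom K1 K0;
  d0 : hom K1 K0;
  int_id : hom K0 K1;
  int_comp : hom (pbk d0 d1) K1;
  d1_id : d1 ∘ int_id = idm K0;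
  d0_id : d0 ∘ int_id = idm K0;
  d1_comp : d1 ∘ int_comp = d1 ∘ pb_fst (pbk d0 d1);
  d0_comp : d0 ∘ int_comp = d0 ∘ pb_snd (pbk d0 d1);
  int_idl : forall (J : S) (u : hom J K1) (e : d0 ∘ (int_id ∘ (d1 ∘ u)) = d1 ∘ u),
    int_comp ∘ pb_pair (pbk d0 d1) e = u;
  int_idr : forall (J : S) (u : hom J K1) (e : d0 ∘ u = d1 ∘ (int_id ∘ (d0 ∘ u))),
    int_comp ∘ pb_pair (pbk d0 d1) e = u;
  int_assoc : forall (J : S) (u v w : hom J K1)
    (uv : d0 ∘ u = d1 ∘ v) (vw : d0 ∘ v = d1 ∘ w)
    (uv_w : d0 ∘ (int_comp ∘ pb_pair (pbk d0 d1) uv) = d1 ∘ w)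
    (u_vw : d0 ∘ u = d1 ∘ (int_comp ∘ pb_pair (pbk d0 d1) vw)),
    int_comp ∘ pb_pair (pbk d0 d1) uv_w = int_comp ∘ pb_pair (pbk d0 d1) u_vw }.

Section Diagrams.
Variables (S : FinLimCategory) (D : IndexedCategory S) (K : InternalCategory S).

Record Diagram := {
  dg :> D (K0 K);
  dg_act : hom (reix (d1 K) dg) (reix (d0 K) dg);
  dg_id : pull dg_act (d1_id K) (d0_id K) = idm (reix (idm _) dg);
  (** With [P = K1 ×_K0 K1], the two arrows [(d1 pb_fst)^* L -> (d0 pb_snd)^* L]. *)
  dg_comp : forall e : d1 K ∘ pb_snd (pbk (d0 K) (d1 K))
                       = d0 K ∘ pb_fst (pbk (d0 K) (d1 K)),
    pull dg_act (d1_comp K) (d0_comp K)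
    = pull dg_act e eq_refl ∘ pull dg_act eq_refl eq_refl }.

Record diagram_hom (L M : Diagram) := {
  dgh :> hom (dg L) (dg M);
  dgh_act : fmap (reix (d0 K)) dgh ∘ dg_act L = dg_act M ∘ fmap (reix (d1 K)) dgh }.

Lemma diagram_hom_eq L M (u v : diagram_hom L M) : dgh u = dgh v -> u = v.
Proof.
case: u v => [u eu] [v ev] /= e; subst v; by rewrite (proof_irrelevance _ eu ev).
Qed.

Program Definition DiagramCategory : Category :=
  {| ob := Diagram; hom := diagram_hom;
     idm := fun L => {| dgh := idm (dg L) |};
     comp := fun L M N v u => {| dgh := dgh v ∘ dgh u |} |}.
Next Obligation. by rewrite !fmap_id comp_idl comp_idr. Qed.
Next Obligation. by rewrite !fmap_comp compA' dgh_act !comp_assoc dgh_act. Qed.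
Next Obligation. by apply: diagram_hom_eq; rewrite /= comp_idl. Qed.
Next Obligation. by apply: diagram_hom_eq; rewrite /= comp_idr. Qed.
Next Obligation. by apply: diagram_hom_eq; rewrite /= comp_assoc. Qed.

(** The structure arrow of the constant diagram is the canonical isomorphism
    [d1^* K0^* A ≅ K1^* A ≅ d0^* K0^* A]. *)
Program Definition constant_diagram (A : D one) : Diagram :=
  {| dg := reix (bang (K0 K)) A;
     dg_act := rebase (bang_uniq (bang (K0 K) ∘ d1 K) (bang (K1 K)))
                      (bang_uniq (bang (K0 K) ∘ d0 K) (bang (K1 K)))
                      (idm (reix (bang (K1 K)) A)) |}.
Next Obligation.
rewrite (pull_rebase _ _ _ _ _ (bang_uniq _ (bang _)) (bang_uniq _ (bang _))
           (bang_uniq _ _) (bang_uniq _ _)).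
by rewrite pull_idm rebase_idm.
Qed.
Next Obligation.
rewrite !(pull_rebase _ _ _ _ _ (bang_uniq _ (bang _)) (bang_uniq _ (bang _))
           (bang_uniq _ _) (bang_uniq _ _)).
by rewrite !pull_idm -rebase_comp comp_idl.
Qed.

Program Definition ConstantDiagram : Functor (D one) DiagramCategory :=
  {| fob := constant_diagram;
     fmap := fun A B u => {| dgh := fmap (reix (bang (K0 K))) u |} |}.
Next Obligation.
rewrite /= /rebase !comp_idr.
set e0 := bang_uniq _ _; set e1 := bang_uniq _ _.
apply: (iso_mono (i := reix_comp e0 B)).
by rewrite !comp_assoc reix_comp_nat to_from comp_idl -(comp_assoc _ (to _) (from _))
  to_from comp_idr reix_comp_nat.
Qed.
Next Obligation. by apply: diagram_hom_eq; rewrite /= fmap_id. Qed.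
Next Obligation. by apply: diagram_hom_eq; rewrite /= fmap_comp. Qed.

End Diagrams.

(** [K^*] has a left adjoint [colim_K] and the arrow [colim_K L -> A] induced by
    [c : L -> K^* A] is invertible.  Left adjoints being unique up to unique
    isomorphism, the choice of [colim] is immaterial; one exists whenever [D] is
    [S]-cocomplete. *)
Definition is_internal_colimit (S : FinLimCategory) (D : IndexedCategory S)
    (K : InternalCategory S) (L : DiagramCategory D K) (A : D one)
    (c : hom L (ConstantDiagram D K A)) : Prop :=
  exists colim : LeftAdjoint (ConstantDiagram D K), is_iso (transpose colim c).

Program Definition map_diagram (S : FinLimCategory) (D D' : IndexedCategory S)
    (H : IndexedFunctor D D') (K : InternalCategory S) (L : Diagram D K) :
    Diagram D' K :=
  {| dg := H (K0 K) (dg L); dg_act := ipush H (dg_act L) |}.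
Next Obligation. by rewrite -ipush_pull dg_id ipush_idm. Qed.
Next Obligation. by rewrite -!ipush_pull -ipush_comp (dg_comp L e). Qed.

Record Exponential (S : Category) (D : IndexedCategory S)
    (U : S) (E : D U) (I : S) (A : D I) := {
  expo : S;
  ex_s : hom expo U;
  ex_t : hom expo I;
  generic : hom (reix ex_s E) (reix ex_t A);
  classify : forall (J : S) (x : hom J U) (y : hom J I),
    hom (reix x E) (reix y A) -> hom J expo;
  classify_s : forall J x y psi, ex_s ∘ @classify J x y psi = x;
  classify_t : forall J x y psi, ex_t ∘ @classify J x y psi = y;
  classify_generic : forall J x y psi,
    pull generic (@classify_s J x y psi) (@classify_t J x y psi) = psi;
  classify_uniq : forall J x y psi (chi : hom J expo)
    (es : ex_s ∘ chi = x) (et : ex_t ∘ chi = y),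
    pull generic es et = psi -> chi = @classify J x y psi }.

Arguments ex_s {S D U E I A} _ : rename.
Arguments ex_t {S D U E I A} _ : rename.
Arguments generic {S D U E I A} _ : rename.
Arguments classify {S D U E I A} _ {J x y} _ : rename.

(** The exponentials are data, as the canonical cocone is built from chosen ones. *)
Definition Exponentiable (S : Category) (D : IndexedCategory S)
    (U : S) (E : D U) : Type :=
  forall (I : S) (A : D I), Exponential E A.

Lemma expo_ext (S : Category) (D : IndexedCategory S) (U : S) (E : D U)
    (I : S) (A : D I) (X : Exponential E A) (J : S) (u v : hom J (expo X))
    (x : hom J U) (y : hom J I) (us : ex_s X ∘ u = x) (ut : ex_t X ∘ u = y)
    (vs : ex_s X ∘ v = x) (vt : ex_t X ∘ v = y) :
  pull (generic X) us ut = pull (generic X) vs vt -> u = v.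
Proof. by move=> e; rewrite (classify_uniq e); symmetry; exact: classify_uniq. Qed.

Section CanonicalCocone.
Variables (S : FinLimCategory) (D : IndexedCategory S).
Variables (U : S) (E : D U) (expE : Exponentiable E) (A : D one).

Let AE := expE A.
Let EE := expE E.

Definition cc_K1 := pbk (ex_t EE) (ex_s AE).
Definition cc_x : hom cc_K1 (expo EE) := pb_fst cc_K1.
Definition cc_d0 : hom cc_K1 (expo AE) := pb_snd cc_K1.

(** [x^*] of the generic arrow of [E^E], as an arrow [(s' x)^* E -> (s d0)^* E]. *)
Definition cc_arrow : hom (reix (ex_s EE ∘ cc_x) E) (reix (ex_s AE ∘ cc_d0) E) :=
  pull (generic EE) eq_refl (pb_sq cc_K1).

Definition cc_d1 : hom cc_K1 (expo AE) :=
  classify AE (pull (generic AE) eq_refl (eq_refl (ex_t AE ∘ cc_d0)) ∘ cc_arrow).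

Lemma cc_d1_s : ex_s AE ∘ cc_d1 = ex_s EE ∘ cc_x.
Proof. exact: classify_s. Qed.

Lemma cc_d1_t : ex_t AE ∘ cc_d1 = ex_t AE ∘ cc_d0.
Proof. exact: classify_t. Qed.

Lemma cc_d1_generic (J : S) (u : hom J cc_K1) a b c
    (e1 : ex_s AE ∘ (cc_d1 ∘ u) = a) (e2 : ex_t AE ∘ (cc_d1 ∘ u) = c)
    (e3 : ex_s EE ∘ cc_x ∘ u = a) (e4 : ex_s AE ∘ cc_d0 ∘ u = b)
    (e5 : ex_s AE ∘ (cc_d0 ∘ u) = b) (e6 : ex_t AE ∘ (cc_d0 ∘ u) = c) :
  pull (generic AE) e1 e2 = pull (generic AE) e5 e6 ∘ pull cc_arrow e3 e4.
Proof.
have e7 : ex_t AE ∘ cc_d0 ∘ u = c by rewrite compA'.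
have <- : pull (pull (generic AE) cc_d1_s cc_d1_t) e3 e7 = pull (generic AE) e1 e2.
  exact: pull_pull.
rewrite (proof_irrelevance _ cc_d1_t (classify_t _ _)).
rewrite (proof_irrelevance _ cc_d1_s (classify_s _ _)) classify_generic.
by rewrite (pull_comp _ _ e3 e4 e7); congr (_ ∘ _); exact: pull_pull.
Qed.

Lemma cc_K1_ext (J : S) (u v : hom J cc_K1) a b
    (ua : ex_s EE ∘ cc_x ∘ u = a) (ub : ex_s AE ∘ cc_d0 ∘ u = b)
    (va : ex_s EE ∘ cc_x ∘ v = a) (vb : ex_s AE ∘ cc_d0 ∘ v = b) :
  cc_d0 ∘ u = cc_d0 ∘ v -> pull cc_arrow ua ub = pull cc_arrow va vb -> u = v.
Proof.
move=> e0 e; apply: pb_ext => //.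
have us : ex_s EE ∘ (cc_x ∘ u) = a by rewrite comp_assoc.
have vs : ex_s EE ∘ (cc_x ∘ v) = a by rewrite comp_assoc.
have ut : ex_t EE ∘ (cc_x ∘ u) = b by rewrite comp_assoc /cc_x pb_sq.
have vt : ex_t EE ∘ (cc_x ∘ v) = b by rewrite comp_assoc /cc_x pb_sq.
apply: (expo_ext (us := us) (ut := ut) (vs := vs) (vt := vt)).
rewrite -(pull_pull _ eq_refl (pb_sq cc_K1) ua ub eq_refl us ut).
by rewrite -(pull_pull _ eq_refl (pb_sq cc_K1) va vb eq_refl vs vt).
Qed.

Lemma cc_id_sq :
  ex_t EE ∘ classify EE (idm (reix (ex_s AE) E)) = ex_s AE ∘ idm (expo AE).
Proof. by rewrite classify_t comp_idr. Qed.

Definition cc_id : hom (expo AE) cc_K1 := pb_pair cc_K1 cc_id_sq.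

Lemma cc_d0_id : cc_d0 ∘ cc_id = idm _.
Proof. exact: pb_pair_snd. Qed.

Lemma cc_arrow_id (J : S) (u : hom J (expo AE)) a
    (ea : ex_s EE ∘ cc_x ∘ (cc_id ∘ u) = a)
    (eb : ex_s AE ∘ cc_d0 ∘ (cc_id ∘ u) = a) :
  pull cc_arrow ea eb = idm _.
Proof.
have xi : cc_x ∘ cc_id = classify EE (idm (reix (ex_s AE) E)).
  exact: pb_pair_fst.
have e : ex_s AE ∘ u = a.
  by rewrite -eb comp_assoc (compA' (ex_s AE)) cc_d0_id comp_idr.
rewrite -(pull_idm E e e) -(classify_generic EE (idm (reix (ex_s AE) E))).
set f1 := classify_s _ _; set f2 := classify_t _ _.
have g1 : ex_s EE ∘ (cc_x ∘ (cc_id ∘ u)) = a by rewrite comp_assoc.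
have g2 : ex_t EE ∘ (cc_x ∘ (cc_id ∘ u)) = a by rewrite comp_assoc /cc_x pb_sq.
rewrite (pull_pull _ f1 f2 e e (chi'' := cc_x ∘ (cc_id ∘ u)) _ g1 g2).
  by rewrite comp_assoc xi.
exact: pull_pull.
Qed.

Lemma cc_s_id : ex_s EE ∘ cc_x ∘ cc_id = ex_s AE.
Proof. rewrite compA' [cc_x ∘ _]pb_pair_fst; exact: classify_s. Qed.

Lemma cc_s_id_gen (J : S) (w : hom J (expo AE)) :
  ex_s EE ∘ cc_x ∘ (cc_id ∘ w) = ex_s AE ∘ cc_d0 ∘ (cc_id ∘ w).
Proof. by rewrite !(comp_assoc _ cc_id) cc_s_id (compA' (ex_s AE)) cc_d0_id comp_idr. Qed.

Lemma cc_arrow_id0 (s1 : ex_s EE ∘ cc_x ∘ cc_id = ex_s AE)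
    (s0 : ex_s AE ∘ cc_d0 ∘ cc_id = ex_s AE) :
  pull cc_arrow s1 s0 = idm _.
Proof.
have h1 : ex_s EE ∘ cc_x ∘ (cc_id ∘ idm _) = ex_s AE by rewrite comp_idr.
have h0 : ex_s AE ∘ cc_d0 ∘ (cc_id ∘ idm _) = ex_s AE by rewrite comp_idr.
rewrite -(cc_arrow_id h1 h0); apply: pull_eq; by rewrite comp_idr.
Qed.

Lemma cc_d1_id : cc_d1 ∘ cc_id = idm _.
Proof.
have s0 : ex_s AE ∘ cc_d0 ∘ cc_id = ex_s AE by rewrite compA' cc_d0_id comp_idr.
have e1 : ex_s AE ∘ (cc_d1 ∘ cc_id) = ex_s AE by rewrite comp_assoc cc_d1_s cc_s_id.
have e2 : ex_t AE ∘ (cc_d1 ∘ cc_id) = ex_t AE.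
  by rewrite comp_assoc cc_d1_t compA' cc_d0_id comp_idr.
have e5 : ex_s AE ∘ (cc_d0 ∘ cc_id) = ex_s AE by rewrite comp_assoc.
have e6 : ex_t AE ∘ (cc_d0 ∘ cc_id) = ex_t AE by rewrite cc_d0_id comp_idr.
apply: (expo_ext (us := e1) (ut := e2) (vs := comp_idr _) (vt := comp_idr _)).
rewrite (cc_d1_generic e1 e2 cc_s_id s0 e5 e6) cc_arrow_id0.
rewrite comp_idr; apply: pull_eq; exact: cc_d0_id.
Qed.

Let P := pbk cc_d0 cc_d1.
Let p : hom P cc_K1 := pb_fst P.
Let q : hom P cc_K1 := pb_snd P.

Lemma cc_mid : ex_s EE ∘ cc_x ∘ q = ex_s AE ∘ cc_d0 ∘ p.
Proof. by rewrite -cc_d1_s !compA' /p /q pb_sq. Qed.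

(** The composite arrow [(s' x p)^* E -> (s d0 p)^* E = (s' x q)^* E -> (s d0 q)^* E]. *)
Definition cc_comp_arrow :
    hom (reix (ex_s EE ∘ cc_x ∘ p) E) (reix (ex_s AE ∘ cc_d0 ∘ q) E) :=
  pull cc_arrow cc_mid eq_refl ∘ pull cc_arrow eq_refl eq_refl.

Lemma cc_comp_sq : ex_t EE ∘ classify EE cc_comp_arrow = ex_s AE ∘ (cc_d0 ∘ q).
Proof. by rewrite classify_t compA'. Qed.

Definition cc_comp : hom P cc_K1 := pb_pair cc_K1 cc_comp_sq.

Lemma cc_d0_comp : cc_d0 ∘ cc_comp = cc_d0 ∘ q.
Proof. exact: pb_pair_snd. Qed.

Lemma cc_arrow_comp (J : S) (u : hom J P) a b c
    (e1 : ex_s EE ∘ cc_x ∘ (cc_comp ∘ u) = a)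
    (e2 : ex_s AE ∘ cc_d0 ∘ (cc_comp ∘ u) = c)
    (e3 : ex_s EE ∘ cc_x ∘ (p ∘ u) = a) (e4 : ex_s AE ∘ cc_d0 ∘ (p ∘ u) = b)
    (e5 : ex_s EE ∘ cc_x ∘ (q ∘ u) = b) (e6 : ex_s AE ∘ cc_d0 ∘ (q ∘ u) = c) :
  pull cc_arrow e1 e2 = pull cc_arrow e5 e6 ∘ pull cc_arrow e3 e4.
Proof.
have xm : cc_x ∘ cc_comp = classify EE cc_comp_arrow by exact: pb_pair_fst.
have h3 : ex_s EE ∘ cc_x ∘ p ∘ u = a by rewrite compA'.
have h4 : ex_s AE ∘ cc_d0 ∘ p ∘ u = b by rewrite compA'.
have h6 : ex_s AE ∘ cc_d0 ∘ q ∘ u = c by rewrite compA'.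
rewrite -(pull_pull cc_arrow eq_refl eq_refl h3 h4 eq_refl e3 e4).
rewrite -(pull_pull cc_arrow cc_mid eq_refl h4 h6 eq_refl e5 e6).
rewrite -(pull_comp _ _ h3 h4 h6) -/cc_comp_arrow.
rewrite -(classify_generic EE cc_comp_arrow).
set f1 := classify_s _ _; set f2 := classify_t _ _.
have g1 : ex_s EE ∘ (cc_x ∘ (cc_comp ∘ u)) = a by rewrite comp_assoc.
have g2 : ex_t EE ∘ (cc_x ∘ (cc_comp ∘ u)) = c by rewrite comp_assoc /cc_x pb_sq.
rewrite (pull_pull _ f1 f2 h3 h6 (chi'' := cc_x ∘ (cc_comp ∘ u)) _ g1 g2).
  by rewrite comp_assoc xm.
exact: pull_pull.
Qed.

Lemma cc_s_comp : ex_s EE ∘ cc_x ∘ cc_comp = ex_s EE ∘ cc_x ∘ p.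
Proof. rewrite compA' [cc_x ∘ _]pb_pair_fst; exact: classify_s. Qed.

Lemma cc_arrow_comp0 (e1 : ex_s EE ∘ cc_x ∘ cc_comp = ex_s EE ∘ cc_x ∘ p)
    (e2 : ex_s AE ∘ cc_d0 ∘ cc_comp = ex_s AE ∘ cc_d0 ∘ q) :
  pull cc_arrow e1 e2 = cc_comp_arrow.
Proof.
have k1 : ex_s EE ∘ cc_x ∘ (cc_comp ∘ idm _) = ex_s EE ∘ cc_x ∘ p.
  by rewrite comp_idr.
have k2 : ex_s AE ∘ cc_d0 ∘ (cc_comp ∘ idm _) = ex_s AE ∘ cc_d0 ∘ q.
  by rewrite comp_idr.
have k3 : ex_s EE ∘ cc_x ∘ (p ∘ idm _) = ex_s EE ∘ cc_x ∘ p by rewrite comp_idr.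
have k4 : ex_s AE ∘ cc_d0 ∘ (p ∘ idm _) = ex_s AE ∘ cc_d0 ∘ p by rewrite comp_idr.
have k5 : ex_s EE ∘ cc_x ∘ (q ∘ idm _) = ex_s AE ∘ cc_d0 ∘ p.
  by rewrite comp_idr cc_mid.
have k6 : ex_s AE ∘ cc_d0 ∘ (q ∘ idm _) = ex_s AE ∘ cc_d0 ∘ q by rewrite comp_idr.
rewrite (pull_eq cc_arrow e1 e2 k1 k2); first by rewrite comp_idr.
rewrite (cc_arrow_comp k1 k2 k3 k4 k5 k6) /cc_comp_arrow.
by congr (_ ∘ _); apply: pull_eq; rewrite comp_idr.
Qed.

Lemma cc_d1_comp : cc_d1 ∘ cc_comp = cc_d1 ∘ p.
Proof.
have pq : cc_d0 ∘ p = cc_d1 ∘ q by exact: pb_sq.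
set a := ex_s EE ∘ cc_x ∘ p; set b := ex_s AE ∘ cc_d0 ∘ p.
set c := ex_s AE ∘ cc_d0 ∘ q; set t := ex_t AE ∘ (cc_d0 ∘ q).
have e1 : ex_s AE ∘ (cc_d1 ∘ cc_comp) = a by rewrite comp_assoc cc_d1_s cc_s_comp.
have e2 : ex_t AE ∘ (cc_d1 ∘ cc_comp) = t.
  by rewrite comp_assoc cc_d1_t compA' cc_d0_comp.
have e3 : ex_s EE ∘ cc_x ∘ cc_comp = a by exact: cc_s_comp.
have e4 : ex_s AE ∘ cc_d0 ∘ cc_comp = c by rewrite compA' cc_d0_comp comp_assoc.
have e5 : ex_s AE ∘ (cc_d0 ∘ cc_comp) = c by rewrite comp_assoc.
have e6 : ex_t AE ∘ (cc_d0 ∘ cc_comp) = t by rewrite cc_d0_comp.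
have f1 : ex_s AE ∘ (cc_d1 ∘ p) = a by rewrite comp_assoc cc_d1_s.
have f2 : ex_t AE ∘ (cc_d1 ∘ p) = t.
  by rewrite comp_assoc cc_d1_t compA' pq comp_assoc cc_d1_t compA'.
have f5 : ex_s AE ∘ (cc_d0 ∘ p) = b by rewrite comp_assoc.
have f6 : ex_t AE ∘ (cc_d0 ∘ p) = t by rewrite pq comp_assoc cc_d1_t compA'.
have g5 : ex_s AE ∘ (cc_d1 ∘ q) = b by rewrite -pq.
have g6 : ex_t AE ∘ (cc_d1 ∘ q) = t by rewrite -pq.
have h5 : ex_s AE ∘ (cc_d0 ∘ q) = c by rewrite comp_assoc.
apply: (expo_ext (us := e1) (ut := e2) (vs := f1) (vt := f2)).
rewrite (cc_d1_generic e1 e2 e3 e4 e5 e6).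
rewrite (cc_d1_generic f1 f2 (eq_refl a) (eq_refl b) f5 f6).
rewrite (pull_eq (generic AE) f5 f6 g5 g6 pq).
rewrite (cc_d1_generic g5 g6 cc_mid (eq_refl c) h5 (eq_refl t)).
rewrite compA' cc_arrow_comp0; congr (_ ∘ _); apply: pull_eq; exact: cc_d0_comp.
Qed.

Lemma cc_arrow_pair (J : S) (u v : hom J cc_K1) (e : cc_d0 ∘ u = cc_d1 ∘ v) a b c
    (e1 : ex_s EE ∘ cc_x ∘ (cc_comp ∘ pb_pair P e) = a)
    (e2 : ex_s AE ∘ cc_d0 ∘ (cc_comp ∘ pb_pair P e) = c)
    (e3 : ex_s EE ∘ cc_x ∘ u = a) (e4 : ex_s AE ∘ cc_d0 ∘ u = b)
    (e5 : ex_s EE ∘ cc_x ∘ v = b) (e6 : ex_s AE ∘ cc_d0 ∘ v = c) :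
  pull cc_arrow e1 e2 = pull cc_arrow e5 e6 ∘ pull cc_arrow e3 e4.
Proof.
have pu : p ∘ pb_pair P e = u by exact: pb_pair_fst.
have qv : q ∘ pb_pair P e = v by exact: pb_pair_snd.
have f3 : ex_s EE ∘ cc_x ∘ (p ∘ pb_pair P e) = a by rewrite pu.
have f4 : ex_s AE ∘ cc_d0 ∘ (p ∘ pb_pair P e) = b by rewrite pu.
have f5 : ex_s EE ∘ cc_x ∘ (q ∘ pb_pair P e) = b by rewrite qv.
have f6 : ex_s AE ∘ cc_d0 ∘ (q ∘ pb_pair P e) = c by rewrite qv.
rewrite (cc_arrow_comp e1 e2 f3 f4 f5 f6).
by congr (_ ∘ _); exact: pull_eq.
Qed.

Lemma cc_d0_pair (J : S) (u v : hom J cc_K1) (e : cc_d0 ∘ u = cc_d1 ∘ v) :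
  cc_d0 ∘ (cc_comp ∘ pb_pair P e) = cc_d0 ∘ v.
Proof. by rewrite comp_assoc cc_d0_comp compA' [q ∘ _]pb_pair_snd. Qed.

Lemma cc_s_pair (J : S) (u v : hom J cc_K1) (e : cc_d0 ∘ u = cc_d1 ∘ v) :
  ex_s EE ∘ cc_x ∘ (cc_comp ∘ pb_pair P e) = ex_s EE ∘ cc_x ∘ u.
Proof. by rewrite comp_assoc cc_s_comp compA' [p ∘ _]pb_pair_fst. Qed.

Lemma cc_mid_pair (J : S) (u v : hom J cc_K1) (e : cc_d0 ∘ u = cc_d1 ∘ v) :
  ex_s EE ∘ cc_x ∘ v = ex_s AE ∘ cc_d0 ∘ u.
Proof. by rewrite -cc_d1_s !compA' e. Qed.

Program Definition canonical_category : InternalCategory S :=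
  {| K0 := expo AE; K1 := cc_K1; d1 := cc_d1; d0 := cc_d0;
     int_id := cc_id; int_comp := cc_comp;
     d1_id := cc_d1_id; d0_id := cc_d0_id;
     d1_comp := cc_d1_comp; d0_comp := cc_d0_comp |}.
Next Obligation.
have ma := cc_mid_pair e; have si := cc_s_id_gen (cc_d1 ∘ u).
have sa : ex_s EE ∘ cc_x ∘ (cc_id ∘ (cc_d1 ∘ u)) = ex_s EE ∘ cc_x ∘ u.
  by rewrite si.
have ua := eq_trans (cc_s_pair e) sa.
have ub : ex_s AE ∘ cc_d0 ∘ (cc_comp ∘ pb_pair P e) = ex_s AE ∘ cc_d0 ∘ u.
  by rewrite !compA' cc_d0_pair.
apply: (cc_K1_ext (ua := ua) (ub := ub) (va := eq_refl) (vb := eq_refl)).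
  exact: cc_d0_pair.
rewrite (cc_arrow_pair ua ub sa (eq_sym ma) eq_refl eq_refl).
by rewrite cc_arrow_id comp_idr.
Qed.
Next Obligation.
have ma := cc_mid_pair e; have si := cc_s_id_gen (cc_d0 ∘ u).
have d0u : cc_d0 ∘ (cc_id ∘ (cc_d0 ∘ u)) = cc_d0 ∘ u.
  by rewrite comp_assoc cc_d0_id comp_idl.
have sb : ex_s AE ∘ cc_d0 ∘ (cc_id ∘ (cc_d0 ∘ u)) = ex_s AE ∘ cc_d0 ∘ u.
  by rewrite -si ma.
have ub : ex_s AE ∘ cc_d0 ∘ (cc_comp ∘ pb_pair P e) = ex_s AE ∘ cc_d0 ∘ u.
  by rewrite !compA' cc_d0_pair d0u.
apply: (cc_K1_ext (ua := cc_s_pair e) (ub := ub) (va := eq_refl) (vb := eq_refl)).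
  by rewrite cc_d0_pair.
rewrite (cc_arrow_pair (cc_s_pair e) ub eq_refl eq_refl ma sb).
by rewrite cc_arrow_id comp_idl.
Qed.
Next Obligation.
have s1 : ex_s EE ∘ cc_x ∘ (cc_comp ∘ pb_pair P uv_w) = ex_s EE ∘ cc_x ∘ u.
  by rewrite cc_s_pair cc_s_pair.
have t1 : ex_s AE ∘ cc_d0 ∘ (cc_comp ∘ pb_pair P uv_w) = ex_s AE ∘ cc_d0 ∘ w.
  by rewrite !compA' cc_d0_pair.
have t2 : ex_s AE ∘ cc_d0 ∘ (cc_comp ∘ pb_pair P u_vw) = ex_s AE ∘ cc_d0 ∘ w.
  by rewrite !compA' !cc_d0_pair.
have t3 : ex_s AE ∘ cc_d0 ∘ (cc_comp ∘ pb_pair P uv) = ex_s AE ∘ cc_d0 ∘ v.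
  by rewrite !compA' cc_d0_pair.
have t4 : ex_s AE ∘ cc_d0 ∘ (cc_comp ∘ pb_pair P vw) = ex_s AE ∘ cc_d0 ∘ w.
  by rewrite !compA' cc_d0_pair.
have m1 := cc_mid_pair uv; have m2 := cc_mid_pair vw.
have m3 : ex_s EE ∘ cc_x ∘ (cc_comp ∘ pb_pair P vw) = ex_s AE ∘ cc_d0 ∘ u.
  by rewrite cc_s_pair.
apply: (cc_K1_ext (ua := s1) (ub := t1) (va := cc_s_pair u_vw) (vb := t2)).
  by rewrite !cc_d0_pair.
rewrite (cc_arrow_pair s1 t1 (cc_s_pair uv) t3 m2 eq_refl).
rewrite (cc_arrow_pair (cc_s_pair uv) t3 eq_refl eq_refl m1 eq_refl).
rewrite (cc_arrow_pair (cc_s_pair u_vw) t2 eq_refl eq_refl m3 t4).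
by rewrite (cc_arrow_pair m3 t4 m1 eq_refl m2 eq_refl) comp_assoc.
Qed.

Program Definition canonical_diagram : Diagram D canonical_category :=
  {| dg := reix (ex_s AE) E : D (K0 canonical_category);
     dg_act := rebase cc_d1_s eq_refl cc_arrow |}.
Next Obligation.
have s0 : ex_s AE ∘ cc_d0 ∘ cc_id = ex_s AE by rewrite compA' cc_d0_id comp_idr.
rewrite (pull_rebase _ _ _ cc_d1_id cc_d0_id (comp_idr _) (comp_idr _) cc_s_id s0).
by rewrite cc_arrow_id0 rebase_idm.
Qed.
Next Obligation.
have e1 : ex_s AE ∘ (cc_d1 ∘ p) = ex_s EE ∘ cc_x ∘ p by rewrite comp_assoc cc_d1_s.
have e2 : ex_s AE ∘ (cc_d0 ∘ p) = ex_s AE ∘ cc_d0 ∘ p by rewrite comp_assoc.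
have e3 : ex_s AE ∘ (cc_d0 ∘ q) = ex_s AE ∘ cc_d0 ∘ q by rewrite comp_assoc.
have e4 : ex_s AE ∘ cc_d0 ∘ cc_comp = ex_s AE ∘ cc_d0 ∘ q.
  by rewrite !compA' cc_d0_comp.
rewrite (pull_rebase _ _ _ _ _ e1 e3 cc_s_comp e4).
rewrite (pull_rebase _ _ _ _ _ e2 e3 cc_mid eq_refl).
rewrite (pull_rebase _ _ _ _ _ e1 e2 eq_refl eq_refl).
by rewrite -rebase_comp cc_arrow_comp0.
Qed.

(** The generic arrow [s^* E -> t^* A]; the target is [K0^* A] because [t] is
    the unique arrow [K0 -> 1]. *)
Program Definition canonical_cocone :
    @hom (DiagramCategory D canonical_category)
      canonical_diagram (ConstantDiagram D canonical_category A) :=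
  {| dgh := pull (generic AE) (comp_idr (ex_s AE)) (bang_uniq _ (bang (expo AE)))
       : hom (dg canonical_diagram) (dg (constant_diagram _ A)) |}.
Next Obligation.
set g := pull _ _ _; set b0 := bang_uniq _ _; set b1 := bang_uniq _ _.
rewrite (fmap_rebase g (eq_refl (ex_s AE ∘ cc_d0)) b1) -rebase_comp.
rewrite (fmap_rebase g cc_d1_s b0) -rebase_comp comp_idl.
congr rebase; symmetry; rewrite /g.
have f0 : ex_s AE ∘ cc_d0 = ex_s AE ∘ cc_d0 by [].
have h0 : ex_t AE ∘ cc_d0 = bang cc_K1 by exact: bang_uniq.
have h1 : ex_t AE ∘ cc_d1 = bang cc_K1 by exact: bang_uniq.
rewrite (pull_pull _ _ _ _ _ (comp_idl cc_d0) f0 h0).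
rewrite (pull_pull _ _ _ _ _ (comp_idl cc_d1) cc_d1_s h1).
have k1 : ex_s AE ∘ (cc_d1 ∘ idm _) = ex_s EE ∘ cc_x by rewrite comp_idr cc_d1_s.
have k2 : ex_t AE ∘ (cc_d1 ∘ idm _) = bang cc_K1 by exact: bang_uniq.
have k5 : ex_s AE ∘ (cc_d0 ∘ idm _) = ex_s AE ∘ cc_d0 by rewrite comp_idr.
have k6 : ex_t AE ∘ (cc_d0 ∘ idm _) = bang cc_K1 by exact: bang_uniq.
rewrite (pull_eq (generic AE) cc_d1_s h1 k1 k2); first by rewrite comp_idr.
rewrite (pull_eq (generic AE) f0 h0 k5 k6); first by rewrite comp_idr.
by rewrite (cc_d1_generic k1 k2 (comp_idr _) (comp_idr _) k5 k6) pull_id.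
Qed.

End CanonicalCocone.

(** The image of a cocone [L -> K^* A] under an indexed functor, using
    [H (K0^* A) ≅ K0^* (H A)]. *)
Program Definition map_cocone (S : FinLimCategory) (D D' : IndexedCategory S)
    (H : IndexedFunctor D D') (K : InternalCategory S) (L : DiagramCategory D K)
    (A : D one) (c : hom L (ConstantDiagram D K A)) :
    @hom (DiagramCategory D' K)
      (map_diagram H L) (ConstantDiagram D' K (H one A)) :=
  {| dgh := to (cmpt_reix H (bang (K0 K)) A) ∘ fmap (H (K0 K)) (dgh c)
       : hom (dg (map_diagram H L)) (dg (constant_diagram K (H one A))) |}.
Next Obligation.
have := dgh_act c; rewrite /= /rebase !comp_idr.
set b0 := bang_uniq _ _; set b1 := bang_uniq _ _ => ec.
apply: (iso_epi (i := cmpt_reix H (d1 K) (dg L))).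
apply: (iso_mono (i := reix_comp b0 (H one A))).
have c0 := cmpt_reix_comp H b0 A; have c1 := cmpt_reix_comp H b1 A.
move: (ipush H (dg_act L)) (ipushE H (dg_act L)) => w ew.
rewrite !compA' iso_tfK ew !fmap_comp !compA'.
rewrite (comp_assoc (fmap _ (fmap _ _))) -!cmpt_reix_nat !compA'.
rewrite -[fmap _ _ ∘ fmap _ (dg_act L)]fmap_comp ec.
rewrite (comp_assoc (fmap _ _) _ (fmap (H _) _)) comp_assoc -c0.
rewrite (comp_assoc (fmap _ _) _ (fmap (H _) _)) [RHS]comp_assoc -c1.
by rewrite !fmap_comp -!comp_assoc -!fmap_comp iso_tfK.
Qed.

Section Coalgebra.
Variables (C : Category) (F : Functor C C).

Record coalgebra := { ca_car :> C; ca_str : hom ca_car (F ca_car) }.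

Record coalgebra_hom (A B : coalgebra) := {
  cah :> hom (ca_car A) (ca_car B);
  cah_str : fmap F cah ∘ ca_str A = ca_str B ∘ cah }.

Lemma coalgebra_hom_eq A B (u v : coalgebra_hom A B) : cah u = cah v -> u = v.
Proof.
case: u v => [u eu] [v ev] /= e; subst v; by rewrite (proof_irrelevance _ eu ev).
Qed.

Program Definition CoalgebraCategory : Category :=
  {| ob := coalgebra; hom := coalgebra_hom;
     idm := fun A => {| cah := idm (ca_car A) |};
     comp := fun A B D v u => {| cah := cah v ∘ cah u |} |}.
Next Obligation. by rewrite fmap_id comp_idl comp_idr. Qed.
Next Obligation. by rewrite fmap_comp compA' cah_str !comp_assoc cah_str. Qed.
Next Obligation. by apply: coalgebra_hom_eq; rewrite /= comp_idl. Qed.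
Next Obligation. by apply: coalgebra_hom_eq; rewrite /= comp_idr. Qed.
Next Obligation. by apply: coalgebra_hom_eq; rewrite /= comp_assoc. Qed.

Program Definition coalgebra_iso (A B : coalgebra)
    (i : Iso (ca_car A) (ca_car B))
    (ei : fmap F (to i) ∘ ca_str A = ca_str B ∘ to i) :
    @Iso CoalgebraCategory A B :=
  {| to := {| cah := to i |} : @hom CoalgebraCategory A B;
     from := {| cah := from i |} : @hom CoalgebraCategory B A |}.
Next Obligation.
apply: (iso_epi (i := i)).
by rewrite compA' -ei comp_assoc -fmap_comp from_to fmap_id comp_idl
  compA' from_to comp_idr.
Qed.
Next Obligation. by apply: coalgebra_hom_eq; rewrite /= from_to. Qed.
Next Obligation. by apply: coalgebra_hom_eq; rewrite /= to_from. Qed.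

End Coalgebra.

Section IndexedCoalgebras.
Variables (S : Category) (D : IndexedCategory S) (F : IndexedFunctor D D).

(** [f^* (A, alpha)] has structure arrow [f^* A -> f^* F A ≅ F f^* A]. *)
Program Definition coalgebra_reix (X Y : S) (f : hom Y X) :
    Functor (CoalgebraCategory (F X)) (CoalgebraCategory (F Y)) :=
  {| fob := fun A : coalgebra (F X) =>
       {| ca_car := reix f (ca_car A);
          ca_str := from (cmpt_reix F f (ca_car A)) ∘ fmap (reix f) (ca_str A) |};
     fmap := fun A B (u : coalgebra_hom A B) => {| cah := fmap (reix f) (cah u) |} |}.
Next Obligation.
apply: (iso_mono (i := cmpt_reix F f (ca_car B))).
rewrite comp_assoc cmpt_reix_nat !compA' !iso_tfK -!fmap_comp.
by rewrite cah_str.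
Qed.
Next Obligation. by apply: coalgebra_hom_eq; rewrite /= fmap_id. Qed.
Next Obligation. by apply: coalgebra_hom_eq; rewrite /= fmap_comp. Qed.

Lemma coalgebra_reix_id_str (X : S) (A : coalgebra (F X)) :
  fmap (F X) (to (reix_id (ca_car A))) ∘ ca_str A
  = ca_str (coalgebra_reix (idm X) A) ∘ to (reix_id (ca_car A)).
Proof.
apply: (iso_mono (i := cmpt_reix F (idm X) (ca_car A))) => /=.
by rewrite comp_assoc cmpt_reix_id !compA' iso_tfK reix_id_nat.
Qed.

Lemma coalgebra_reix_comp_str (X Y Z : S) (f : hom Y X) (g : hom Z Y)
    (h : hom Z X) (e : f ∘ g = h) (A : coalgebra (F X)) :
  fmap (F Z) (to (reix_comp e (ca_car A)))
    ∘ ca_str (coalgebra_reix g (coalgebra_reix f A))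
  = ca_str (coalgebra_reix h A) ∘ to (reix_comp e (ca_car A)).
Proof.
apply: (iso_mono (i := cmpt_reix F _ (ca_car A))) => /=.
rewrite [LHS]comp_assoc cmpt_reix_comp !compA' !iso_tfK -fmap_comp iso_tfK.
by rewrite reix_comp_nat.
Qed.

Definition coalgebra_reix_id (X : S) (A : CoalgebraCategory (F X)) :
    Iso A (coalgebra_reix (idm X) A) :=
  coalgebra_iso (B := coalgebra_reix (idm X) A) (i := reix_id (ca_car A))
    (coalgebra_reix_id_str A).

Definition coalgebra_reix_comp (X Y Z : S) (f : hom Y X) (g : hom Z Y)
    (h : hom Z X) (e : f ∘ g = h) (A : CoalgebraCategory (F X)) :
    Iso (coalgebra_reix g (coalgebra_reix f A)) (coalgebra_reix h A) :=
  coalgebra_iso (A := coalgebra_reix g (coalgebra_reix f A))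
    (B := coalgebra_reix h A) (i := reix_comp e (ca_car A))
    (coalgebra_reix_comp_str e A).

Program Definition CoalgebraIndexing : IndexedCategory S :=
  {| fib := fun X => CoalgebraCategory (F X);
     reix := coalgebra_reix;
     reix_id := coalgebra_reix_id;
     reix_comp := coalgebra_reix_comp |}.
Next Obligation. by apply: coalgebra_hom_eq; apply: reix_id_nat. Qed.
Next Obligation. by apply: coalgebra_hom_eq; apply: reix_comp_nat. Qed.
Next Obligation. by apply: coalgebra_hom_eq; exact: (reix_unitl e (ca_car A)). Qed.
Next Obligation. by apply: coalgebra_hom_eq; exact: (reix_unitr e (ca_car A)). Qed.
Next Obligation. by apply: coalgebra_hom_eq; apply: reix_coh. Qed.

Program Definition forget_at (X : S) : Functor (CoalgebraCategory (F X)) (D X) :=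
  {| fob := fun A : coalgebra (F X) => ca_car A;
     fmap := fun A B (u : coalgebra_hom A B) => cah u |}.

Program Definition id_iso (C : Category) (a : C) : Iso a a :=
  {| to := idm a; from := idm a |}.
Next Obligation. exact: comp_idl. Qed.
Next Obligation. exact: comp_idl. Qed.

Program Definition Forget : IndexedFunctor CoalgebraIndexing D :=
  {| cmpt := forget_at : forall X, Functor (CoalgebraIndexing X) (D X);
     cmpt_reix := fun X Y f A => id_iso (reix f (ca_car A)) |}.
Next Obligation. by rewrite comp_idl comp_idr. Qed.
Next Obligation. by rewrite comp_idl. Qed.
Next Obligation. by rewrite fmap_id !comp_idl comp_idr. Qed.

End IndexedCoalgebras.

Definition small_based (C : FinLimCategory)
    (F : IndexedFunctor (CanonicalIndexing C) (CanonicalIndexing C)) : Prop :=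
  exists (V : C) (E : CoalgebraIndexing F V) (expE : Exponentiable E),
    forall A : CoalgebraIndexing F one,
      is_internal_colimit (map_cocone (Forget F) (canonical_cocone expE A)).

Definition has_indexed_final_coalgebra (C : FinLimCategory)
    (F : IndexedFunctor (CanonicalIndexing C) (CanonicalIndexing C)) : Prop :=
  exists T : CoalgebraIndexing F one,
    forall X : C, is_terminal (reix (bang X) T).

(* Main.v *)
From Corelib Require Import ssreflect.
From Stdlib Require Import List.
Require Import Defs.

Set Implicit Arguments.
Unset Strict Implicit.
Unset Printing Implicit Defensive.

(** Coalgebras over a nonterminal base reduce to coalgebras over [one]: summing
    along [X -> 1] gives a functor [total] from [F^X]-coalgebras to
    [F^1]-coalgebras which does not change the domain of the carrier and is left
    adjoint to [X^*].  Hence [X^*] preserves terminal objects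
    ([terminal_reindexed]), and only a terminal [F^1]-coalgebra is needed.

    Let [S] be the total coalgebra of the generating family [(E, V)].  A
    coalgebra morphism from the total coalgebra of [y^* E], for [y : J -> V], to
    [A] is the same as an arrow [J -> A^E] over [V].  Therefore the total
    coalgebra of [E] reindexed to [S^E ×_V S^E] carries a parallel pair into [S]
    through which every parallel pair of morphisms from some [y^* E] factors
    ([generic_pair]).  Let [q : S -> T] be the coequalizer of that pair,
    computed in [C].  Every coalgebra [A] is covered by the total coalgebra of
    [s^* E] over [A^E], so [q] identifies all parallel pairs of coalgebra
    morphisms into [S] ([generic_quotient]).  This makes [T] terminal.

    A morphism [A -> T] exists because the canonical cocone presents [A] as a
    coequalizer of two coalgebra morphisms into that cover ([cover_epi],
    [cover_descent]): the cover maps to [S] by the projection [s^* E -> E], and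
    the two composites into [S] are identified by [q].

    It is unique because a morphism [u : A -> T] lifts to [S] along an
    epimorphism [B -> A]: the pullback of [q] along [u] is an epimorphism as
    coequalizers are stable, and it carries a coalgebra structure as [F^1]
    sends it to a weak pullback ([lift_along_coequalizer]).  Two morphisms
    [A -> T] thus lift simultaneously to a parallel pair into [S], which [q]
    identifies ([parallel_into_quotient_eq]). *)

(** * Epimorphisms, coequalizers and their stability *)

Definition is_epi (C : Category) (a b : C) (e : hom a b) : Prop :=
  forall (c : C) (u v : hom b c), u ∘ e = v ∘ e -> u = v.

Lemma epi_comp (C : Category) (a b c : C) (f : hom b c) (e : hom a b) :
  is_epi f -> is_epi e -> is_epi (f ∘ e).
Proof. by move=> hf he d u v; rewrite !comp_assoc => /he/hf. Qed.

Definition is_coequalizer (C : Category) (a b c : C) (f g : hom a b)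
    (q : hom b c) : Prop :=
  q ∘ f = q ∘ g /\
  forall (x : C) (h : hom b x), h ∘ f = h ∘ g -> exists! k : hom c x, k ∘ q = h.

Lemma coequalizer_epi (C : Category) (a b c : C) (f g : hom a b) (q : hom b c) :
  is_coequalizer f g q -> is_epi q.
Proof.
move=> [e univ] x u v euv.
have ef : u ∘ q ∘ f = u ∘ q ∘ g by rewrite !compA' e.
have [k [_ kuniq]] := univ x (u ∘ q) ef.
by rewrite -(kuniq u (eq_refl _)); apply: kuniq.
Qed.

(** Arrows of the shape [false ⇉ true]; the two arrows are indexed by [bool]. *)
Definition pair_hom (i j : bool) : Type :=
  match i, j with
  | false, true => bool
  | true, false => Empty_set
  | _, _ => unit
  end.

Program Definition ParallelPair : Category :=
  {| ob := bool; hom := pair_hom;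
     idm := fun i => match i with true => tt | false => tt end;
     comp := fun i j k =>
       match i, j, k return pair_hom j k -> pair_hom i j -> pair_hom i k with
       | false, false, false => fun _ _ => tt
       | false, false, true => fun g _ => g
       | false, true, true => fun _ f => f
       | true, true, true => fun _ _ => tt
       | false, true, false => fun g _ => match g with end
       | true, false, false => fun _ f => f
       | true, false, true => fun _ _ => tt
       | true, true, false => fun g _ => g
       end |}.
Next Obligation. by move: f; case: a; case: b => // -[]. Qed.
Next Obligation. by move: f; case: a; case: b => // -[]. Qed.
Next Obligation. by move: f g h; case: a; case: b; case: c; case: d => // ? []. Qed.

Lemma ParallelPair_finite : finite_category ParallelPair.
Proof.
split; first by exists (true :: false :: nil) => -[]; [left | right; left].
case=> -[].
- by exists (tt :: nil) => -[]; left.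
- by exists nil => -[].
- by exists (true :: false :: nil) => -[]; [left | right; left].
- by exists (tt :: nil) => -[]; left.
Qed.

Section Coequalizers.
Variables (C : Category) (a b : C) (f g : hom a b).

Program Definition pair_functor : Functor ParallelPair C :=
  {| fob := fun i : bool => if i then b else a;
     fmap := fun i j =>
       match i, j return pair_hom i j -> hom (if i then b else a) (if j then b else a) with
       | false, false => fun _ => idm a
       | true, true => fun _ => idm b
       | false, true => fun m => if m then f else g
       | true, false => fun m => match m with end
       end |}.
Next Obligation. by case: a0. Qed.
Next Obligation.
by move: f0 g0; case: a0; case: b0; case: c => // *; rewrite ?comp_idl ?comp_idr.
Qed.

Definition pair_cocone (c : C) (q : hom b c) (i : ParallelPair) :
    hom (pair_functor i) c :=
  match i return hom (pair_functor i) c with true => q | false => q ∘ f end.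

Lemma pair_cocone_is_cocone (c : C) (q : hom b c) :
  q ∘ f = q ∘ g -> is_cocone (pair_cocone q).
Proof. by move=> e [] [] [] //=; rewrite ?comp_idr. Qed.

Lemma cocone_at_source (c : C) (k : forall i, hom (pair_functor i) c) :
  is_cocone k -> k false = k true ∘ f /\ k true ∘ f = k true ∘ g.
Proof.
move=> hk; have ef : k true ∘ f = k false := hk false true true.
by split=> //; rewrite ef; symmetry; exact: hk false true false.
Qed.

Lemma colimit_coequalizer (c : C) (k : forall i, hom (pair_functor i) c) :
  is_colimit k -> is_coequalizer f g (k true).
Proof.
move=> [hk univ]; have [ks e] := cocone_at_source hk; split=> // x h eh.
have [u [eu uniq]] := univ x _ (pair_cocone_is_cocone eh).
exists u; split; first exact: eu true.
move=> v ev; apply: uniq => -[]; first exact: ev.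
by rewrite ks comp_assoc ev.
Qed.

Lemma coequalizer_colimit (c : C) (q : hom b c) :
  is_coequalizer f g q -> is_colimit (pair_cocone q).
Proof.
move=> [e univ]; split; first exact: pair_cocone_is_cocone.
move=> x l hl; have [ls el] := cocone_at_source hl.
have [u [eu uniq]] := univ x (l true) el.
exists u; split; last by move=> v ev; apply: uniq; exact: ev true.
by case=> //=; rewrite ls -eu comp_assoc.
Qed.

End Coequalizers.

Lemma coequalizer_exists (C : Category) (a b : C) (f g : hom a b) :
  has_finite_colimits C -> exists (c : C) (q : hom b c), is_coequalizer f g q.
Proof.
move=> hC; have [c [k hk]] := hC _ (pair_functor f g) ParallelPair_finite.
by exists c, (k true); exact: colimit_coequalizer.
Qed.

(** Two arrows [u, v : B -> c] of [C] become parallel arrows of [C/X] with target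
    the projection [X × c -> X], so the slice sees their difference. *)
Lemma slice_epi (C : FinLimCategory) (X : C) (A B : Slice X) (e : @hom (Slice X) A B) :
  is_epi e -> is_epi (sl_map e).
Proof.
move=> he c u v euv.
pose prod := pbk (bang X) (bang c).
pose Z : Slice X := {| sl_dom := prod; sl_arr := pb_fst prod |}.
have tri (w : hom (sl_dom B) c) : bang X ∘ sl_arr B = bang c ∘ w by exact: bang_uniq.
pose lift w : @hom (Slice X) B Z :=
  {| sl_map := pb_pair prod (tri w) : hom (sl_dom B) (sl_dom Z);
     sl_tri := pb_pair_fst prod (tri w) |}.
have eqlift : lift u = lift v.
  apply: he; apply: slice_hom_eq; apply: pb_ext => /=; rewrite !comp_assoc.
    by rewrite !pb_pair_fst.
  by rewrite !pb_pair_snd.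
by rewrite -(pb_pair_snd prod (tri u)) -(pb_pair_snd prod (tri v)) -[pb_pair _ _]/(sl_map (lift u)) eqlift.
Qed.

(** Seen in the slice over its codomain, [q] is a coequalizer with terminal
    target, so [h^*] takes it to a coequalizer with terminal target. *)
Lemma coequalizer_pullback_epi (C : FinLimCategory) (a b c : C) (f g : hom a b)
    (q : hom b c) (x : C) (h : hom x c) :
  stable_finite_colimits C -> is_coequalizer f g q -> is_epi (pb_fst (pbk h q)).
Proof.
move=> [_ stable] hq; have [e univ] := hq.
pose A : Slice c := {| sl_dom := a; sl_arr := q ∘ f |}.
pose B : Slice c := {| sl_dom := b; sl_arr := q |}.
pose T : Slice c := {| sl_dom := c; sl_arr := idm c |}.
pose f' : @hom (Slice c) A B := {| sl_map := f : hom (sl_dom A) (sl_dom B); sl_tri := eq_refl |}.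
pose g' : @hom (Slice c) A B := {| sl_map := g : hom (sl_dom A) (sl_dom B); sl_tri := eq_sym e |}.
pose q' : @hom (Slice c) B T :=
  {| sl_map := q : hom (sl_dom B) (sl_dom T); sl_tri := comp_idl q |}.
have hq' : is_coequalizer f' g' q'.
  split; first exact: slice_hom_eq.
  move=> Z k ek.
  have [u [eu uniq]] := univ _ (sl_map k) (f_equal (@sl_map _ _ _ _) ek).
  have tri : sl_arr Z ∘ u = sl_arr T.
    by apply: (coequalizer_epi hq); rewrite compA' eu (sl_tri k) comp_idl.
  exists {| sl_map := u : hom (sl_dom T) (sl_dom Z); sl_tri := tri |}.
  split; first exact: slice_hom_eq.
  move=> v ev; apply: slice_hom_eq; apply: uniq.
  exact: (f_equal (@sl_map _ _ _ _) ev).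
have [hk huniq] := stable _ _ h _ _ _ _ ParallelPair_finite (coequalizer_colimit hq').
pose R := reix (D := CanonicalIndexing C) h.
have epi : is_epi (fmap R q').
  move=> Z u v euv.
  have hl : is_cocone (D := compose_functor R (pair_functor f' g'))
              (fun i => u ∘ fmap R (pair_cocone f' g' q' i)).
    by move=> i j m; rewrite compA' hk.
  have [w [_ wuniq]] := huniq Z _ hl.
  have <- : w = u by exact: wuniq.
  apply: wuniq => -[]; first by symmetry; exact: euv.
  change (v ∘ fmap R (q' ∘ f') = u ∘ fmap R (q' ∘ f')).
  by rewrite !fmap_comp !comp_assoc euv.
(* The carrier of [h^*] of the terminal object is isomorphic to [x]. *)
have iso_epi' : is_epi (pb_fst (pbk h (idm c))).
  have sq : h ∘ idm x = idm c ∘ h by rewrite comp_idl comp_idr.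
  move=> z u v euv; rewrite -(comp_idr u) -(comp_idr v) -(pb_pair_fst (pbk h (idm c)) sq).
  by rewrite !comp_assoc euv.
have -> : pb_fst (pbk h q) = pb_fst (pbk h (idm c)) ∘ sl_map (fmap R q').
  by rewrite /= pb_pair_fst.
exact: epi_comp iso_epi' (slice_epi epi).
Qed.

(** * Coalgebras for a fixed endofunctor *)

Section CoalgebraConstructions.
Variables (D : Category) (F : Functor D D).

(** The structure arrows of [A] and [B] restricted to [P] form a cone over
    [F f] and [F g], and [s] is any arrow which that cone induces. *)
Lemma coalgebra_weak_pullback (A B T : coalgebra F) (f : coalgebra_hom A T)
    (g : coalgebra_hom B T) (P : D) (p : hom P A) (q : hom P B) :
  is_weak_pullback (fmap F f) (fmap F g) (fmap F p) (fmap F q) ->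
  f ∘ p = g ∘ q ->
  exists s : hom P (F P),
    fmap F p ∘ s = ca_str A ∘ p /\ fmap F q ∘ s = ca_str B ∘ q.
Proof.
move=> [_ weak] e; apply: weak.
by rewrite !comp_assoc !cah_str !compA' e.
Qed.

(** The part of the creation of coequalizers by the forgetful functor that
    provides the structure arrow. *)
Lemma coalgebra_coequalizer (A B : coalgebra F) (f g : coalgebra_hom A B)
    (T : D) (q : hom (ca_car B) T) :
  is_coequalizer (cah f) (cah g) q ->
  exists t : hom T (F T), fmap F q ∘ ca_str B = t ∘ q.
Proof.
move=> [e univ].
have es : fmap F q ∘ ca_str B ∘ cah f = fmap F q ∘ ca_str B ∘ cah g.
  by rewrite !compA' -!cah_str !comp_assoc -!fmap_comp e.
by have [t [et _]] := univ _ _ es; exists t.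
Qed.

Lemma coalgebra_hom_descent (A B T : coalgebra F) (e : coalgebra_hom B A)
    (h : coalgebra_hom B T) (k : hom (ca_car A) (ca_car T)) :
  is_epi (cah e) -> k ∘ cah e = cah h ->
  fmap F k ∘ ca_str A = ca_str T ∘ k.
Proof.
move=> epi ek; apply: epi.
by rewrite !compA' -cah_str ek comp_assoc -fmap_comp ek cah_str.
Qed.

End CoalgebraConstructions.

(** * The adjunction between total objects and reindexing *)

Section Total.
Variable C : FinLimCategory.
Implicit Types X Y J : C.

Definition total_ob X : Slice (one : C) := {| sl_dom := X; sl_arr := bang X |}.

Definition over_one (A B : Slice (one : C)) (m : hom (sl_dom A) (sl_dom B)) :
    @hom (Slice (one : C)) A B := {| sl_map := m; sl_tri := bang_uniq _ _ |}.

(** The counit at [A] of the adjunction between composition with [f] and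
    reindexing along [f], as an arrow of [C]. *)
Definition counit X Y (f : hom Y X) (A : Slice X) :
    hom (sl_dom (slice_reix f A)) (sl_dom A) := pb_snd (pbk f (sl_arr A)).

Lemma sl_map_comp X (A B D : Slice X) (g : @hom (Slice X) B D)
    (f : @hom (Slice X) A B) : sl_map (g ∘ f) = sl_map g ∘ sl_map f.
Proof. by []. Qed.

Lemma counit_fmap X Y (f : hom Y X) (A B : Slice X) (u : @hom (Slice X) A B) :
  counit f B ∘ sl_map (fmap (slice_reix f) u) = sl_map u ∘ counit f A.
Proof. exact: pb_pair_snd. Qed.

Lemma counit_comp X Y J (f : hom Y X) (g : hom J Y) (h : hom J X)
    (e : f ∘ g = h) (A : Slice X) :
  counit h A ∘ sl_map (to (slice_reix_comp e A))
  = counit f A ∘ counit g (slice_reix f A).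
Proof. exact: pb_pair_snd. Qed.

Lemma counit_ext X Y (f : hom Y X) (A : Slice X) (B : Slice Y)
    (u v : @hom (Slice Y) B (slice_reix f A)) :
  counit f A ∘ sl_map u = counit f A ∘ sl_map v -> u = v.
Proof.
move=> e; apply: slice_hom_eq; apply: pb_ext => //.
by rewrite [LHS](sl_tri u) [RHS](sl_tri v).
Qed.

(** The transpose [A -> J^* B] of an arrow from the domain of [A] to [B]. *)
Definition mate J (A : Slice J) (B : Slice (one : C)) (m : hom (sl_dom A) (sl_dom B)) :
    @hom (Slice J) A (slice_reix (bang J) B) :=
  {| sl_map := pb_pair (pbk (bang J) (sl_arr B))
       (bang_uniq (bang J ∘ sl_arr A) (sl_arr B ∘ m))
       : hom (sl_dom A) (sl_dom (slice_reix (bang J) B));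
     sl_tri := pb_pair_fst _ _ |}.

Lemma mateK J (A : Slice J) (B : Slice (one : C)) (m : hom (sl_dom A) (sl_dom B)) :
  counit (bang J) B ∘ sl_map (mate m) = m.
Proof. exact: pb_pair_snd. Qed.

Variable F : IndexedFunctor (CanonicalIndexing C) (CanonicalIndexing C).
Let DD := CoalgebraIndexing F.

Definition slice_unit J (A : Slice J) :
    @hom (Slice J) A (slice_reix (bang J) (total_ob (sl_dom A))) :=
  mate (B := total_ob (sl_dom A)) (idm (sl_dom A)).

(** The structure arrow corresponds by adjunction to
    [A -> F^J A -> F^J (J^* A) ≅ J^* (F^1 A)], where the middle arrow is the
    image of the unit. *)
Definition total J (B : DD J) : DD one :=
  let A : Slice J := ca_car B in
  {| ca_car := total_ob (sl_dom A) : CanonicalIndexing C one;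
     ca_str := over_one (A := total_ob (sl_dom A))
       (B := F one (total_ob (sl_dom A)))
       (counit (bang J) (F one (total_ob (sl_dom A)))
        ∘ sl_map (to (cmpt_reix F (bang J) (total_ob (sl_dom A)))
                  ∘ fmap (F J) (slice_unit A) ∘ ca_str B)) |}.

Definition carrier J (B : DD J) : C := sl_dom (ca_car B : Slice J).
Definition cmap J (A B : DD J) (u : @hom (DD J) A B) : hom (carrier A) (carrier B) :=
  sl_map (cah u : @hom (Slice J) _ _).

(** The adjunct [m] of a coalgebra morphism [u : B -> J^* A] is a coalgebra
    morphism: transposed back to [C/J], the claim is that of [u], by naturality
    of [F^J J^* ≅ J^* F^1]. *)
Lemma total_hom_str J (B : DD J) (A : DD one)
    (u : @hom (DD J) B (reix (bang J) A)) :
  let m := over_one (A := total_ob (carrier B)) (B := ca_car A)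
             (counit (bang J) (ca_car A) ∘ cmap u) in
  fmap (F one) m ∘ ca_str (total B) = ca_str A ∘ m.
Proof.
move=> m; have um : fmap (slice_reix (bang J)) m ∘ slice_unit (ca_car B) = cah u.
  apply: counit_ext; rewrite sl_map_comp comp_assoc counit_fmap.
  by rewrite compA' mateK comp_idr.
have str : fmap (slice_reix (bang J)) (fmap (F one) m)
      ∘ (to (cmpt_reix F (bang J) (total_ob (carrier B)))
         ∘ fmap (F J) (slice_unit (ca_car B)) ∘ ca_str B)
    = fmap (slice_reix (bang J)) (ca_str A) ∘ cah u.
  have nat := cmpt_reix_nat F (bang J) m.
  rewrite !comp_assoc -nat !compA' (comp_assoc (fmap _ _) (fmap _ _)) -fmap_comp.
  rewrite um (cah_str u) compA'. by rewrite iso_tfK.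
apply: slice_hom_eq.
have := f_equal (fun w => counit (bang J) _ ∘ sl_map w) str.
rewrite !sl_map_comp.
  by rewrite !comp_assoc !counit_fmap.
Qed.

Lemma cmap_inj J (A B : DD J) (u v : @hom (DD J) A B) : cmap u = cmap v -> u = v.
Proof. by move=> e; apply: coalgebra_hom_eq; apply: slice_hom_eq. Qed.

Lemma cmap_comp J (A B D : DD J) (v : @hom (DD J) B D) (u : @hom (DD J) A B) :
  cmap (v ∘ u) = cmap v ∘ cmap u.
Proof. by []. Qed.

Definition untranspose J (B : DD J) (A : DD one)
    (u : @hom (DD J) B (reix (bang J) A)) : @hom (DD one) (total B) A :=
  {| cah := over_one (A := total_ob (carrier B)) (B := ca_car A)
              (counit (bang J) (ca_car A) ∘ cmap u)
            : hom (ca_car (total B)) (ca_car A);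
     cah_str := total_hom_str u |}.

Lemma total_unit_str J (B : DD J) :
  fmap (F J) (slice_unit (ca_car B)) ∘ ca_str B
  = ca_str (reix (bang J) (total B)) ∘ slice_unit (ca_car B).
Proof.
apply: (iso_mono (i := cmpt_reix F (bang J) (total_ob (carrier B)))).
rewrite [RHS]comp_assoc iso_tfK.
apply: (counit_ext (f := bang J) (A := F one (total_ob (carrier B)))).
set s := RHS; change s with (counit (bang J) (F one (total_ob (carrier B)))
  ∘ (sl_map (fmap (slice_reix (bang J)) (ca_str (total B)))
     ∘ sl_map (slice_unit (ca_car B)))).
rewrite [RHS]comp_assoc counit_fmap compA' mateK comp_idr.
congr (_ ∘ sl_map _).
by rewrite comp_assoc.
Qed.

Definition total_unit J (B : DD J) : @hom (DD J) B (reix (bang J) (total B)) :=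
  {| cah := slice_unit (ca_car B)
       : hom (ca_car B) (ca_car (reix (bang J) (total B)));
     cah_str := total_unit_str B |}.

Definition transpose_total J (B : DD J) (A : DD one) (m : @hom (DD one) (total B) A) :
    @hom (DD J) B (reix (bang J) A) :=
  fmap (reix (bang J)) m ∘ total_unit B.

Lemma transpose_totalK J (B : DD J) (A : DD one) (m : @hom (DD one) (total B) A) :
  untranspose (transpose_total m) = m.
Proof.
apply: cmap_inj.
change (counit (bang J) (ca_car A)
  ∘ (sl_map (fmap (slice_reix (bang J)) (cah m)) ∘ sl_map (slice_unit (ca_car B)))
  = cmap m).
by rewrite comp_assoc counit_fmap compA' mateK comp_idr.
Qed.

Lemma untranspose_inj J (B : DD J) (A : DD one)
    (u v : @hom (DD J) B (reix (bang J) A)) :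
  untranspose u = untranspose v -> u = v.
Proof.
move=> e; apply: coalgebra_hom_eq; apply: (counit_ext (f := bang J)).
exact: (f_equal (fun w => cmap w) e).
Qed.

Definition total_fmap J (A B : DD J) (u : @hom (DD J) A B) :
    @hom (DD one) (total A) (total B) := untranspose (total_unit B ∘ u).

Lemma cmap_total_fmap J (A B : DD J) (u : @hom (DD J) A B) :
  cmap (total_fmap u) = cmap u.
Proof.
change (counit (bang J) _ ∘ (sl_map (slice_unit (ca_car B)) ∘ cmap u) = cmap u).
by rewrite comp_assoc mateK comp_idl.
Qed.

Definition total_counit X Y (f : hom Y X) (B : DD X) :
    @hom (DD one) (total (reix f B)) (total B) :=
  untranspose (to (reix_comp (bang_uniq (bang X ∘ f) (bang Y)) (total B))
               ∘ fmap (reix f) (total_unit B)).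

Lemma cmap_total_counit X Y (f : hom Y X) (B : DD X) :
  cmap (total_counit f B) = counit f (ca_car B).
Proof.
set e := bang_uniq (bang X ∘ f) (bang Y).
change (counit (bang Y) (total_ob (carrier B))
  ∘ (sl_map (to (slice_reix_comp e (total_ob (carrier B))))
     ∘ sl_map (fmap (slice_reix f) (slice_unit (ca_car B)))) = counit f (ca_car B)).
by rewrite comp_assoc counit_comp compA' counit_fmap comp_assoc mateK comp_idl.
Qed.

(** Reindexing a family [psi] of coalgebra morphisms along [chi] is
    precomposition on total coalgebras.  So generic arrows of an exponential
    become arrows through which all others factor. *)
Lemma untranspose_pull U J J' (E : DD U) (A : DD one) (x : hom J U) (chi : hom J' J)
    (psi : @hom (DD J) (reix x E) (reix (bang J) A)) (x' : hom J' U)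
    (ex : x ∘ chi = x') (ey : bang J ∘ chi = bang J') :
  untranspose (pull psi ex ey)
  = untranspose psi ∘ (total_counit chi (reix x E) ∘ total_fmap (from (reix_comp ex E))).
Proof.
apply: cmap_inj; rewrite !cmap_comp cmap_total_counit cmap_total_fmap.
change (counit (bang J') (ca_car A)
   ∘ (sl_map (to (slice_reix_comp ey (ca_car A)))
      ∘ sl_map (fmap (slice_reix chi) (cah psi)) ∘ cmap (from (reix_comp ex E)))
  = counit (bang J) (ca_car A) ∘ cmap psi
    ∘ (counit chi (ca_car (reix x E)) ∘ cmap (from (reix_comp ex E)))).
by rewrite 2!comp_assoc counit_comp !compA' (comp_assoc (counit chi _)) counit_fmap !compA'.
Qed.

(** A right adjoint preserves terminal objects. *)
Lemma terminal_reindexed (T : DD one) : is_terminal T ->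
  forall X, is_terminal (reix (bang X) T).
Proof.
move=> hT X A; have [m [_ muniq]] := hT (total A).
exists (transpose_total m); split=> // u _; apply: untranspose_inj.
by rewrite transpose_totalK; exact: muniq.
Qed.

End Total.

(** * Quotients that identify all parallel pairs *)

Section StableQuotients.
Variables (C : FinLimCategory).
Variable F : IndexedFunctor (CanonicalIndexing C) (CanonicalIndexing C).
Let DD := CoalgebraIndexing F.
Hypothesis stable : stable_finite_colimits C.
Hypothesis weak : pullbacks_to_weak_pullbacks (F one).
Variables (S T : DD one) (q : @hom (DD one) S T).
Variables (P : C) (f g : hom P (carrier S)).
Hypothesis hq : is_coequalizer f g (cmap q).

(** [B] is the pullback of [q] along [k]: stability makes its projection to [A]
    an epimorphism, and the weak pullback provides its structure arrow. *)
Lemma lift_along_coequalizer (A : DD one) (k : @hom (DD one) A T) :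
  exists (B : DD one) (e : @hom (DD one) B A) (r : @hom (DD one) B S),
    is_epi (cmap e) /\ k ∘ e = q ∘ r.
Proof.
pose R := pbk (cmap k) (cmap q).
pose R1 := total_ob R.
pose p1 := over_one (A := R1) (B := ca_car A) (pb_fst R).
pose r1 := over_one (A := R1) (B := ca_car S) (pb_snd R).
have sq : cah k ∘ p1 = cah q ∘ r1 by apply: slice_hom_eq; exact: pb_sq.
have hR : is_pullback (cah k) (cah q) p1 r1.
  split=> // X a b ab; have ab' := f_equal (@sl_map _ _ _ _) ab.
  exists (over_one (A := X) (B := R1) (pb_pair R ab')); split.
    by split; apply: slice_hom_eq; [exact: pb_pair_fst | exact: pb_pair_snd].
  move=> u [ua ub]; apply: slice_hom_eq; apply: pb_ext.
    by rewrite pb_pair_fst -ua.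
  by rewrite pb_pair_snd -ub.
have [s [sp sr]] := coalgebra_weak_pullback (weak hR) sq.
pose B : DD one := {| ca_car := R1 : CanonicalIndexing C one; ca_str := s |}.
exists B, {| cah := p1 : hom (ca_car B) (ca_car A); cah_str := sp |},
  {| cah := r1 : hom (ca_car B) (ca_car S); cah_str := sr |}; split.
  exact: coequalizer_pullback_epi stable hq.
exact: coalgebra_hom_eq.
Qed.

(** Both morphisms lift to [S] over a common cover of [A]. *)
Lemma parallel_into_quotient_eq :
  (forall (B : DD one) (u v : @hom (DD one) B S), q ∘ u = q ∘ v) ->
  forall (A : DD one) (u v : @hom (DD one) A T), u = v.
Proof.
move=> hS A u v.
have [B [e [r [epi er]]]] := lift_along_coequalizer u.
have [B' [e' [r' [epi' er']]]] := lift_along_coequalizer (v ∘ e).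
apply: cmap_inj; apply: (epi_comp epi epi'); rewrite -!cmap_comp !comp_assoc.
by congr cmap; rewrite er er' compA'; exact: hS.
Qed.

End StableQuotients.

(** * Canonical cocones as coequalizers *)

Lemma internal_colimit_exists (S : FinLimCategory) (D : IndexedCategory S)
    (K : InternalCategory S) (L : DiagramCategory D K) (A : D one)
    (c : hom L (ConstantDiagram D K A)) :
  is_internal_colimit c ->
  forall (B : D one) (u : hom L (ConstantDiagram D K B)),
  exists v : hom A B, fmap (ConstantDiagram D K) v ∘ c = u.
Proof.
move=> [colim [g [eg _]]] B u; exists (transpose colim u ∘ g).
rewrite -{1}(transpose_unit colim c) comp_assoc -fmap_comp compA' eg comp_idr.
exact: transpose_unit.
Qed.

Lemma internal_colimit_epi (S : FinLimCategory) (D : IndexedCategory S)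
    (K : InternalCategory S) (L : DiagramCategory D K) (A : D one)
    (c : hom L (ConstantDiagram D K A)) :
  is_internal_colimit c ->
  forall (B : D one) (v w : hom A B),
  fmap (ConstantDiagram D K) v ∘ c = fmap (ConstantDiagram D K) w ∘ c -> v = w.
Proof.
move=> [colim [g [_ eg]]] B v w e.
have tr (t : hom A B) :
    t ∘ transpose colim c = transpose colim (fmap (ConstantDiagram D K) t ∘ c).
  by apply: transpose_uniq; rewrite fmap_comp compA' transpose_unit.
by rewrite -(comp_idr v) -(comp_idr w) -eg !comp_assoc !tr e.
Qed.

(** An arrow on the total object of [L] that coequalizes the domain map and the
    action is a cocone on [L]. *)
Lemma diagram_hom_to_constant (C : FinLimCategory) (K : InternalCategory C)
    (L : Diagram (CanonicalIndexing C) K) (X : C)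
    (h : hom (sl_dom (dg L : Slice (K0 K))) X) :
  h ∘ counit (d1 K) (dg L) = h ∘ (counit (d0 K) (dg L) ∘ sl_map (dg_act L)) ->
  exists u : diagram_hom L (constant_diagram (D := CanonicalIndexing C) K (total_ob X)),
    counit (bang (K0 K)) (total_ob X) ∘ sl_map (dgh u) = h.
Proof.
move=> e; pose Z := total_ob X.
pose u : @hom (Slice _) (dg L) (slice_reix (bang (K0 K)) Z) :=
  mate (A := dg L) (B := Z) h.
have act : fmap (reix (D := CanonicalIndexing C) (d0 K)) u ∘ dg_act L
           = dg_act (constant_diagram (D := CanonicalIndexing C) K Z)
             ∘ fmap (reix (D := CanonicalIndexing C) (d1 K)) u.
  pose b0 := bang_uniq (bang (K0 K) ∘ d0 K) (bang (K1 K)).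
  pose b1 := bang_uniq (bang (K0 K) ∘ d1 K) (bang (K1 K)).
  pose to0 := sl_map (to (slice_reix_comp b0 Z)).
  pose from0 := sl_map (from (slice_reix_comp b0 Z)).
  have tf : to0 ∘ from0 = idm _ :=
    f_equal (@sl_map _ _ _ _) (to_from (slice_reix_comp b0 Z)).
  apply: (iso_mono (i := slice_reix_comp b0 Z)).
  apply: (counit_ext (f := bang (K1 K)) (A := Z)).
  change (counit (bang (K1 K)) Z
     ∘ (to0 ∘ (sl_map (fmap (slice_reix (d0 K)) u) ∘ sl_map (dg_act L)))
   = counit (bang (K1 K)) Z
     ∘ (to0 ∘ (from0 ∘ idm _ ∘ sl_map (to (slice_reix_comp b1 Z))
               ∘ sl_map (fmap (slice_reix (d1 K)) u)))).
  rewrite comp_idr !compA' (comp_assoc to0 from0) tf comp_idl.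
  rewrite 2!(comp_assoc (counit _ _)) !counit_comp !compA'.
  rewrite counit_fmap (comp_assoc (counit (d0 K) _)) counit_fmap.
  by rewrite !comp_assoc mateK e !comp_assoc.
exists {| dgh := u : hom (dg L)
            (dg (constant_diagram (D := CanonicalIndexing C) K Z));
          dgh_act := act |}.
exact: (mateK (A := dg L) (B := Z) h).
Qed.

Section SmallBased.
Variables (C : FinLimCategory).
Variable F : IndexedFunctor (CanonicalIndexing C) (CanonicalIndexing C).
Let DD := CoalgebraIndexing F.
Variables (V : C) (E : DD V) (expE : Exponentiable E).
Hypothesis dense : forall A : DD one,
  is_internal_colimit (map_cocone (Forget F) (canonical_cocone expE A)).

Definition cover_source (A : DD one) : DD one := total (reix (ex_s (expE A)) E).

Definition cover (A : DD one) : @hom (DD one) (cover_source A) A :=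
  untranspose (dgh (canonical_cocone expE A)).

(** The total coalgebra of [d1^* L], for the canonical diagram [L]: with
    [relation_dom] and [relation_cod] it presents [A] as a quotient of
    [cover_source A]. *)
Definition relations (A : DD one) : DD one :=
  total (reix (d1 (canonical_category expE A)) (reix (ex_s (expE A)) E)).

Definition relation_dom (A : DD one) : @hom (DD one) (relations A) (cover_source A) :=
  total_counit (d1 (canonical_category expE A)) (reix (ex_s (expE A)) E).

Definition relation_cod (A : DD one) : @hom (DD one) (relations A) (cover_source A) :=
  total_counit (d0 (canonical_category expE A)) (reix (ex_s (expE A)) E)
  ∘ total_fmap (dg_act (canonical_diagram expE A)).

(** Identifies the canonical cocone with [cover] through the adjunction, so that
    its universal property in the fibre over [K0] becomes one of [cover] in [C]. *)
Lemma constant_map_cover (A : DD one) (Z : Slice (one : C))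
    (v : @hom (Slice (one : C)) (ca_car A) Z) :
  counit (bang _) Z
   ∘ sl_map (dgh (fmap (ConstantDiagram (CanonicalIndexing C) _) v
              ∘ map_cocone (Forget F) (canonical_cocone expE A)))
  = sl_map v ∘ cmap (cover A).
Proof.
set K := canonical_category expE A; set c := dgh (canonical_cocone expE A).
change (counit (bang (K0 K)) Z
  ∘ (sl_map (fmap (slice_reix (bang (K0 K))) v) ∘ (idm _ ∘ cmap c))
  = sl_map v ∘ (counit (bang (K0 K)) (ca_car A) ∘ cmap c)).
by rewrite comp_idl comp_assoc counit_fmap compA'.
Qed.

Lemma cover_epi (A : DD one) : is_epi (cmap (cover A)).
Proof.
move=> X v w e.
pose v' := over_one (A := ca_car A) (B := total_ob X) v.
pose w' := over_one (A := ca_car A) (B := total_ob X) w.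
suff e' : v' = w' by exact: (f_equal (fun t => sl_map t) e').
apply: (internal_colimit_epi (dense A)); apply: diagram_hom_eq.
apply: (counit_ext (f := bang _)).
by rewrite !constant_map_cover.
Qed.

Lemma cover_descent (A : DD one) (X : C) (h : hom (carrier (cover_source A)) X) :
  h ∘ cmap (relation_dom A) = h ∘ cmap (relation_cod A) ->
  exists v : hom (carrier A) X, v ∘ cmap (cover A) = h.
Proof.
rewrite cmap_comp !cmap_total_counit cmap_total_fmap => e.
pose L := map_diagram (Forget F) (canonical_diagram expE A).
have act : sl_map (dg_act L) = cmap (dg_act (canonical_diagram expE A)).
  exact: eq_trans (comp_idr _) (comp_idl _).
have [u eu] := @diagram_hom_to_constant _ _ L X h ltac:(by rewrite act).
have [v ev] := internal_colimit_exists (dense A) (B := total_ob X) u.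
exists (sl_map v).
by rewrite -(constant_map_cover (A := A) v) ev.
Qed.

(** * The terminal coalgebra *)

(** An arrow from [J] to the kernel pair of [s : S^E -> V] is a pair of morphisms
    from the same family [y^* E] to [S], by the universal property of [S^E]. *)
Lemma generic_pair (S : DD one) :
  exists (P : DD one) (p1 p2 : @hom (DD one) P S),
  forall (J : C) (y : hom J V) (a b : @hom (DD one) (total (reix y E)) S),
  exists w : @hom (DD one) (total (reix y E)) P, p1 ∘ w = a /\ p2 ∘ w = b.
Proof.
pose SE := expE S; pose Q := pbk (ex_s SE) (ex_s SE).
pose x := ex_s SE ∘ pb_fst Q.
have t1 : ex_t SE ∘ pb_fst Q = bang Q by exact: bang_uniq.
have t2 : ex_t SE ∘ pb_snd Q = bang Q by exact: bang_uniq.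
have s2 : ex_s SE ∘ pb_snd Q = x by rewrite -pb_sq.
exists (total (reix x E)), (untranspose (pull (generic SE) (eq_refl x) t1)),
  (untranspose (pull (generic SE) s2 t2)) => J y a b.
pose ca := classify SE (transpose_total a); pose cb := classify SE (transpose_total b).
have sq : ex_s SE ∘ ca = ex_s SE ∘ cb by rewrite !classify_s.
pose chi := pb_pair Q sq.
have chi1 : pb_fst Q ∘ chi = ca by exact: pb_pair_fst.
have chi2 : pb_snd Q ∘ chi = cb by exact: pb_pair_snd.
have ex : x ∘ chi = y by rewrite /x compA' chi1 classify_s.
have et : bang Q ∘ chi = bang J by exact: bang_uniq.
exists (total_counit chi (reix x E) ∘ total_fmap (from (reix_comp ex E))).
rewrite -!(untranspose_pull _ ex et); split.
  rewrite (pull_pull _ _ _ _ _ chi1 (classify_s _ _) (classify_t _ _)).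
  by rewrite classify_generic transpose_totalK.
rewrite (pull_pull _ _ _ _ _ chi2 (classify_s _ _) (classify_t _ _)).
by rewrite classify_generic transpose_totalK.
Qed.

(** Precomposing with the cover of [B] reduces any parallel pair to one that
    factors through the generic pair. *)
Lemma generic_quotient (S : DD one) : has_finite_colimits C ->
  exists (T : DD one) (q : @hom (DD one) S T) (P : C) (f g : hom P (carrier S)),
  is_coequalizer f g (cmap q) /\
  forall (B : DD one) (u v : @hom (DD one) B S), q ∘ u = q ∘ v.
Proof.
move=> hC; have [P [p1 [p2 gen]]] := generic_pair S.
have [T0 [q0 hq]] := coequalizer_exists (cmap p1) (cmap p2) hC.
pose T1 := total_ob T0.
pose q1 := over_one (A := ca_car S) (B := T1) q0.
have hq1 : is_coequalizer (C := Slice one) (cah p1) (cah p2) q1.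
  have [e univ] := hq; split; first exact: slice_hom_eq.
  move=> X h eh.
  have [k [ek uniq]] := univ _ (sl_map h) (f_equal (@sl_map _ _ _ _) eh).
  exists (over_one (A := T1) k); split; first exact: slice_hom_eq.
  move=> k' ek'; apply: slice_hom_eq; apply: uniq.
  exact: (f_equal (@sl_map _ _ _ _) ek').
have [t et] := coalgebra_coequalizer hq1.
pose T : DD one := {| ca_car := T1 : CanonicalIndexing C one; ca_str := t |}.
pose q : @hom (DD one) S T := {| cah := q1 : hom (ca_car S) (ca_car T); cah_str := et |}.
exists T, q, (carrier P), (cmap p1), (cmap p2); split=> // B u v.
apply: cmap_inj; apply: (cover_epi (A := B)).
have [w [ew1 ew2]] := gen _ _ (u ∘ cover B) (v ∘ cover B).
rewrite -!cmap_comp -!comp_assoc -ew1 -ew2 !cmap_comp !comp_assoc.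
by have [-> _] := hq.
Qed.

(** In the quotient of the total coalgebra of [E] that identifies all parallel
    pairs, the projections [s^* E -> E] become cocones, so they induce a morphism
    from every coalgebra. *)
Lemma terminal_over_one : stable_finite_colimits C ->
  pullbacks_to_weak_pullbacks (F one) -> exists T : DD one, is_terminal T.
Proof.
move=> hC hpb; have [hcol _] := hC.
have [T [q [P [f [g [hq qu]]]]]] := generic_quotient (total E) hcol.
exists T => A.
have [v ev] : exists v : hom (carrier A) (carrier T),
    v ∘ cmap (cover A) = cmap (q ∘ total_counit (ex_s (expE A)) E).
  apply: cover_descent; rewrite -!cmap_comp -!comp_assoc.
  by congr cmap; exact: qu.
pose h := q ∘ total_counit (ex_s (expE A)) E.
pose v1 := over_one (A := ca_car A) (B := ca_car T) v.
have hv : fmap (F one) v1 ∘ ca_str A = ca_str T ∘ v1.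
  apply: (coalgebra_hom_descent (e := cover A) (h := h)).
    move=> X a b eab; apply: slice_hom_eq; apply: (cover_epi (A := A)).
    exact: (f_equal (@sl_map _ _ _ _) eab).
  exact: slice_hom_eq.
exists {| cah := v1 : hom (ca_car A) (ca_car T); cah_str := hv |}; split=> // w _.
exact: (parallel_into_quotient_eq hC hpb hq (@qu)).
Qed.

End SmallBased.

Theorem theorem3p1 (C : FinLimCategory)
    (HC : stable_finite_colimits C)
    (F : IndexedFunctor (CanonicalIndexing C) (CanonicalIndexing C))
    (HF : small_based F)
    (Hpb : pullbacks_to_weak_pullbacks (F one)) :
  has_indexed_final_coalgebra F.
Proof.
have [V [E [expE dense]]] := HF.
have [T hT] := terminal_over_one dense HC Hpb.
by exists T; exact: terminal_reindexed.
Qed.
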